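(* Let $\alpha\ge0$ and define $$D^{(\alpha)}_{\mathsf{in},n}=\sum_{(\xi,r)\in X^{(n)}}|\xi|^\alpha 1_{B^{\mathbb{T}_n}_{r}(o)}(\xi),\qquad D^{(\alpha)}_{\mathsf{in}}=\sum_{(\xi,r)\in X}|\xi|^\alpha 1_{B_{r}(o)}(\xi),$$ where $|\xi|$ is the toroidal distance to the origin $o$ in the first sum and the Euclidean norm in the second. Then $D^{(\alpha)}_{\mathsf{in},n}$ converges in distribution to $D^{(\alpha)}_{\mathsf{in}}$ as $n\to\infty$. Moreover, if $s\le d$ then $\mathbb{P}(D^{(\alpha)}_{\mathsf{in}}=\infty)=1$, whereas if $s>d$ then $D^{(0)}_{\mathsf{in}}$ is Poisson distributed with mean $\kappa_d\mathbb{E}R^d$. Finally, if $\alpha>0$ and $s>d$, then with $p^{(\alpha)}_{\mathsf{in},t}=\mathbb{P}(D^{(\alpha)}_{\mathsf{in}}>t)$, $$\lim_{t\to\infty}t^{(s-d)/\alpha}p^{(\alpha)}_{\mathsf{in},t}=\frac{d\kappa_d\beta}{s-d},$$ where $\kappa_d$ is the volume of the unit ball in $\mathbb{R}^d$.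
   Context: Fix an integer $d\ge2$. For $n\ge1$, $\mathbb{T}_n$ is the torus obtained from $[-n/2,n/2]^d$ by identifying opposite faces, with toroidal distance ${\rm d}_{\mathbb{T}_n}$; $B^{\mathbb{T}_n}_r(\xi)=\{\eta\in\mathbb{T}_n:{\rm d}_{\mathbb{T}_n}(\xi,\eta)\le r\}$ and $B_r(\xi)$ is the closed Euclidean ball in $\mathbb{R}^d$. $R$ is a nonnegative random variable with absolutely continuous distribution such that $\lim_{h\to\infty}h^s\mathbb{P}(R>h)=\beta$ for some $\beta,s\in(0,\infty)$. $X^{(n)}$ is a homogeneous Poisson point process of intensity $1$ on $\mathbb{T}_n$, each point independently marked with a mark in $[0,\infty)$ distributed as $R$ (points written $(\xi,r)$); $X$ is the analogous independently marked Poisson point process of intensity $1$ on $\mathbb{R}^d$. *)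

(* Defs.v *)
From HB Require Import structures.
From mathcomp Require Import all_boot all_order all_algebra.
From mathcomp Require Import all_classical all_reals all_analysis.
From mathcomp Require Import measurable_realfun.

Set Implicit Arguments.
Unset Strict Implicit.
Unset Printing Implicit Defensive.

Import Order.TTheory GRing.Theory Num.Theory.
Import numFieldNormedType.Exports numFieldTopology.Exports.

Local Open Scope classical_set_scope.
Local Open Scope ring_scope.

Section defs.
Variable R : realType.

(** Points of R^d are represented as d.-tuples of reals; [d.-tuple R]
    carries the product (Borel) sigma-algebra of the library. *)

Definition eucl_norm (d : nat) (x : d.-tuple R) : R :=
  Num.sqrt (\sum_(i < d) (tnth x i) ^+ 2).

(** Lebesgue measure on R^d, characterized by its values on half-open
    boxes ]a,b] (this determines it uniquely on the product sigma-algebra). *)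
Definition is_lebesgue_Rd (d : nat) (lam : set (d.-tuple R) -> \bar R) : Prop :=
  forall a b : d.-tuple R, (forall i, tnth a i <= tnth b i) ->
    lam [set x | forall i, tnth a i < tnth x i <= tnth b i] =
    (\prod_(i < d) (tnth b i - tnth a i))%:E.

Definition unit_ball_volume (d : nat) (lam : set (d.-tuple R) -> \bar R) : \bar R :=
  lam [set x | eucl_norm x <= 1].

(** The torus T_n: the cube [-n/2,n/2]^d with opposite faces identified.
    We represent it by the fundamental domain [-n/2,n/2)^d (one
    representative per point), with Lebesgue measure restricted to it. *)
Definition torus_domain (d n : nat) : set (d.-tuple R) :=
  [set x | forall i, - (n%:R / 2) <= tnth x i < n%:R / 2].

Definition circle_dist0 (n : nat) (u : R) : R :=
  let w := u - n%:R * (Num.floor (u / n%:R))%:~R in Num.min w (n%:R - w).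

Definition torus_norm (d n : nat) (x : d.-tuple R) : R :=
  Num.sqrt (\sum_(i < d) (circle_dist0 n (tnth x i)) ^+ 2).

(** Poisson probabilities (with the correct value at rate 0; note that the
    library's [poisson_pmf] is 1 at rate 0 by convention, so we do not use it). *)
Definition poisson_p (a : R) (k : nat) : R :=
  expR (- a) * a ^+ k / (k`!)%:R.

(** Intensity measure of an independently marked Poisson process whose
    ground intensity is [lam] restricted to [D] and whose marks have law [mu]:
    Lambda(C) = int_D mu({r | (x,r) in C}) lam(dx). *)
Definition marked_intensity (d : nat) (lam : set (d.-tuple R) -> \bar R)
    (D : set (d.-tuple R)) (mu : set R -> \bar R)
    (C : set (d.-tuple R * R)) : \bar R :=
  (\int[lam]_(x in D) mu [set r | C (x, r)])%E.

Definition is_poisson_process (dO : measure_display) (Omega : measurableType dO)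
    (P : probability Omega R) (dT : measure_display) (T : measurableType dT)
    (Lam : set T -> \bar R) (N : Omega -> {measure set T -> \bar R}) : Prop :=
  [/\ (forall w (A : set T), measurable A ->
         N w A = +oo%E \/ exists k : nat, N w A = (k%:R)%:E),
      (forall A : set T, measurable A -> measurable_fun [set: Omega] (fun w => N w A)),
      (forall A : set T, measurable A -> (Lam A < +oo)%E -> forall k : nat,
         P [set w | N w A = (k%:R)%:E] = (poisson_p (fine (Lam A)) k)%:E),
      (forall A : set T, measurable A -> Lam A = +oo%E ->
         P [set w | N w A = +oo%E] = 1%E) &
      (forall (k : nat) (A : 'I_k -> set T) (m : 'I_k -> nat),
         (forall i, measurable (A i)) -> (forall i, (Lam (A i) < +oo)%E) ->
         (forall i j, i != j -> A i `&` A j = set0) ->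
         P (\bigcap_(i in [set: 'I_k]) [set w | N w (A i) = ((m i)%:R)%:E]) =
         (\prod_(i < k) P [set w | N w (A i) = ((m i)%:R)%:E])%E)].

(** sum over the points (xi, r) of a counting measure [M] of
    |xi|^alpha 1{|xi| <= r}, i.e. the integral against [M]; [nrm] is the
    norm used (toroidal or Euclidean). *)
Definition D_in (d : nat) (nrm : d.-tuple R -> R) (alpha : R)
    (M : set (d.-tuple R * R) -> \bar R) : \bar R :=
  (\int[M]_z (if nrm z.1 <= z.2 then (nrm z.1) `^ alpha else 0)%:E)%E.

(** convergence in distribution of [0,+oo]-valued random variables
    (possibly on different probability spaces), via distribution functions
    at continuity points of the limit. *)
Definition cvg_in_distribution (dn : nat -> measure_display)
    (On : forall n, measurableType (dn n)) (Pn : forall n, probability (On n) R)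
    (Xn : forall n, On n -> \bar R)
    (dO : measure_display) (O : measurableType dO) (P : probability O R)
    (X : O -> \bar R) : Prop :=
  forall t : R, P [set w | X w = t%:E] = 0%E ->
    (fun n => Pn n [set w | (Xn n w <= t%:E)%E]) @ \oo -->
    P [set w | (X w <= t%:E)%E].

End defs.

(* Main.v *)
Require Import Defs.
From HB Require Import structures.
From mathcomp Require Import all_boot all_order all_algebra.
From mathcomp Require Import all_classical all_reals all_analysis.
From mathcomp Require Import measurable_realfun.
From mathcomp Require Import ring lra.
Import Order.TTheory GRing.Theory Num.Theory.
Import numFieldNormedType.Exports numFieldTopology.Exports.
Local Open Scope classical_set_scope.
Local Open Scope ring_scope.

(** On the fundamental domain of the torus the toroidal and Euclidean norms
    agree, so the in-degree on the torus has the law of the integral of the same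
    summand over the restriction of the process on R^d to that domain; as the
    domains exhaust R^d, these integrals increase to the limit in-degree.

    By Fubini and the scaling of Lebesgue measure, the intensity of the points
    (x, r) with rho < |x| <= r is kappa_d E[(R^d - rho^d)_+]. For s <= d it is
    infinite, hence so is the number of points. For s > d the layer-cake formula
    shows that it is equivalent to d kappa_d beta rho^(d-s) / (s-d), and the
    in-degree is a compound Poisson variable with regularly varying jumps: it
    exceeds t essentially only when a single jump does. *)

(** * Poisson counts and the law of Poisson integrals *)

(** The processes live on unrelated probability spaces, and [is_poisson_process] prescribes only
    counts, jointly for disjoint sets of finite intensity. Equality in law of two integrals
    therefore has to be rebuilt from counts: for a simple function the distribution function is an
    explicit series in the intensities of the level sets, and a nonnegative measurable function is a
    monotone limit of simple ones.

    For s <= d the points counted are those with 1 < |x| <= r, because there the summand is at least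
    1 for every alpha >= 0. The case s = d needs no separate treatment: the intensity of the points
    beyond rho stays above one positive constant for all large rho, which a finite intensity forbids
    by continuity from above.

    For s > d the threshold in the layer-cake integral is (rho^d + y)^(1/d) >= rho, so the tail
    estimate holds uniformly in y. A jump |x|^alpha exceeds v exactly when |x| exceeds v^(1/alpha),
    which turns rho^(d-s) into v^(-(s-d)/alpha). Counts enter the tail bounds only through P(N >=
    1), P(N >= 2) and an exponential moment. *)

Section exponential_series.
Context {R : realType}.
Local Open Scope ereal_scope.

Lemma nneseries_expR (a : R) : (0 <= a)%R ->
  \sum_(k <oo) (a ^+ k / k`!%:R)%:E = (expR a)%:E.
Proof.
move=> a0; rewrite /expR -EFin_lim; last exact: is_cvg_series_exp_coeff.
by apply/congr_lim/funext => n; rewrite /= /series /= -sumEFin.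
Qed.

Lemma poisson_p_ge0 (a : R) k : (0 <= a -> 0 <= poisson_p a k)%R.
Proof. by move=> a0; rewrite divr_ge0 ?mulr_ge0 ?expR_ge0 ?exprn_ge0. Qed.

(** This is the generating function of the Poisson law. At [z = 1] it gives total mass 1; at
    [z = expR 1] it is the exponential moment behind the tail bound on counts. *)
Lemma nneseries_poisson_p_geom (a z : R) : (0 <= a)%R -> (0 <= z)%R ->
  \sum_(k <oo) (z ^+ k * poisson_p a k)%:E = (expR (a * z - a))%:E.
Proof.
move=> a0 z0; rewrite [in RHS]addrC expRD EFinM -(nneseries_expR (a * z)) ?mulr_ge0//.
rewrite -nneseriesZl; last first.
  by move=> n _; rewrite lee_fin divr_ge0 ?exprn_ge0 ?mulr_ge0.
apply: eq_eseriesr => n _; rewrite -EFinM /poisson_p exprMn; congr EFin.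
by ring.
Qed.

End exponential_series.

Section poisson_process.
Context {R : realType} {dO : measure_display} {Omega : measurableType dO}.
Context {P : probability Omega R} {dT : measure_display} {T : measurableType dT}.
Context {Lam : set T -> \bar R} {N : Omega -> {measure set T -> \bar R}}.
Hypothesis HN : is_poisson_process P Lam N.
Local Open Scope ereal_scope.

Lemma poisson_process_measurable A : measurable A ->
  measurable_fun [set: Omega] (fun w => N w A).
Proof. by case: HN => _ + _ _ _; exact. Qed.

Lemma poisson_process_valued A w : measurable A ->
  N w A = +oo \/ exists k : nat, N w A = k%:R%:E.
Proof. by case: HN => + _ _ _ _; exact. Qed.

Lemma poisson_process_level_measurable A (x : \bar R) : measurable A ->
  measurable [set w | N w A = x].
Proof.
move=> mA; rewrite (_ : mkset _ = [set: Omega] `&` (N ^~ A) @^-1` [set x]).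
  exact: (poisson_process_measurable _ mA).
by rewrite setTI.
Qed.

Lemma poisson_process_integral_measurable (g : T -> \bar R) :
  (forall z, 0 <= g z) -> measurable_fun setT g ->
  measurable_fun [set: Omega] (fun w => \int[N w]_z g z).
Proof.
move=> g0 mg; apply: measurable_fun_integral_kernel => // A mA.
exact: poisson_process_measurable.
Qed.

(** Restriction realizes the laws of all the torus processes on the one space carrying the process
    on R^d, where monotone convergence is available. *)
Lemma poisson_process_restr (E : set T) (mE : measurable E) :
  is_poisson_process P (fun A => Lam (A `&` E)) (fun w => mrestr (N w) mE).
Proof.
have [H1 H2 H3 H4 H5] := HN; split.
- by move=> w A mA; apply: H1; exact: measurableI.
- by move=> A mA; apply: H2; exact: measurableI.
- by move=> A mA; apply: H3; exact: measurableI.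
- by move=> A mA; apply: H4; exact: measurableI.
- move=> k A m mA LA dA; apply: H5 => //; first by move=> i; exact: measurableI.
  by move=> i j /dA ij0; rewrite setIACA ij0 set0I.
Qed.

Section finite_intensity.
Context {A : set T}.
Hypotheses (mA : measurable A) (L0 : 0 <= Lam A) (Loo : Lam A < +oo).
Let a := fine (Lam A).
Let a0 : (0 <= a)%R. Proof. exact: fine_ge0. Qed.

Lemma poisson_process_pmf k : P [set w | N w A = k%:R%:E] = (poisson_p a k)%:E.
Proof. by case: HN => _ _ + _ _; exact. Qed.

(** The probabilities of the finite values already sum to 1, so nothing is left for the value
    +oo. *)
Lemma poisson_process_infty : P [set w | N w A = +oo] = 0.
Proof.
have mk := poisson_process_level_measurable _ _ mA.
rewrite (_ : mkset _ = ~` \bigcup_(k : nat) [set w | N w A = k%:R%:E]); last first.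
  apply/seteqP; split => w /=; first by move=> Noo [k _ /=]; rewrite Noo.
  by move=> nk; case: (poisson_process_valued _ w mA) => // -[k kN]; case: nk; exists k.
rewrite probability_setC; last exact: bigcup_measurable.
rewrite measure_bigcup//=; last first.
  by apply/trivIsetP => i j _ _ ij; rewrite -subset0 => w/= [+ Nj];
    rewrite Nj => -[] /eqP; rewrite eqr_nat eq_sym (negbTE ij).
suff -> : \sum_(i <oo | i \in [set: nat]) P [set w | N w A = i%:R%:E] = 1.
  by rewrite subee.
under eq_eseriesl do rewrite in_setT.
under eq_eseriesr do rewrite poisson_process_pmf.
have := nneseries_poisson_p_geom _ _ a0 ler01; rewrite mulr1 subrr expR0 => <-.
by apply: eq_eseriesr => k _; rewrite expr1n mul1r.
Qed.

Lemma poisson_process_ge1 : P [set w | N w A != 0] = (1 - expR (- a))%:E.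
Proof.
have := poisson_process_pmf 0; rewrite /poisson_p expr0 fact0 divr1 mulr1.
rewrite EFinB => <-; rewrite -probability_setC.
  by congr (P _); apply/seteqP; split => w /= /eqP.
exact: poisson_process_level_measurable.
Qed.

Lemma poisson_process_ge2 :
  P [set w | N w A != 0 /\ N w A != 1] = (1 - expR (- a) * (1 + a))%:E.
Proof.
have p0 := poisson_process_pmf 0; rewrite /poisson_p expr0 fact0 divr1 mulr1 in p0.
have p1 := poisson_process_pmf 1; rewrite /poisson_p expr1 factS fact0 divr1 in p1.
rewrite mulrDr mulr1 EFinB EFinD -p0 -p1 -measureU ?probability_setC//.
- rewrite -probability_setC; last first.
    by apply: measurableU; exact: poisson_process_level_measurable.
  congr (P _); apply/seteqP; split => w /=.
    by move=> [/eqP ? /eqP ?] [].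
  by move=> /not_orP[/eqP ? /eqP ?].
- exact: poisson_process_level_measurable.
- exact: poisson_process_level_measurable.
- by rewrite -subset0 => w /= [+ N1]; rewrite N1 => -[] /eqP; rewrite oner_eq0.
Qed.

(* Markov's inequality for the exponential moment of N A. *)
Lemma poisson_process_tail (K : R) :
  P [set w | K%:E < N w A] <= (expR (a * expR 1 - a - K))%:E.
Proof.
have mk := poisson_process_level_measurable _ _ mA.
pose F (k : nat) := if (K < k%:R)%R then [set w | N w A = k%:R%:E] else set0.
have mF k : measurable (F k) by rewrite /F; case: ifP.
(* Term by term: the weight e^(k - K) is at least 1 when k > K, and [F k] is empty otherwise. *)
have PF k : P (F k) <= (expR (- K))%:E * (expR 1 ^+ k * poisson_p a k)%:E.
  have p0 : (0 <= poisson_p a k)%R by exact: poisson_p_ge0.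
  rewrite /F; case: ifP => Kk; last first.
    by rewrite measure0 -EFinM lee_fin !mulr_ge0 ?expR_ge0 ?exprn_ge0 ?expR_ge0.
  rewrite poisson_process_pmf -EFinM lee_fin -expRM_natl mulrA -expRD.
  by rewrite ler_peMl// -[leLHS]expR0 ler_expR mulr1 addrC subr_ge0 ltW.
rewrite expRD mulrC EFinM -nneseries_poisson_p_geom ?expR_ge0//.
rewrite -nneseriesZl; last first.
  by move=> n _; rewrite lee_fin mulr_ge0 ?exprn_ge0 ?expR_ge0 ?poisson_p_ge0.
apply: (@le_trans _ _ (P ([set w | N w A = +oo] `|` \bigcup_k F k))).
  apply: le_measure; rewrite ?inE.
  - rewrite -[X in measurable X]setTI; apply: emeasurable_fun_o_infty => //.
    exact: poisson_process_measurable.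
  - by apply: measurableU => //; exact: bigcup_measurable.
  - move=> w /= KN; case: (poisson_process_valued _ w mA) => [|[k kN]]; first by left.
    by right; exists k => //; rewrite /F; move: KN; rewrite kN lte_fin => ->.
apply: (@le_trans _ _ (P [set w | N w A = +oo] + P (\bigcup_k F k))).
  by apply: measureU2 => //; exact: bigcup_measurable.
rewrite poisson_process_infty add0e.
apply: (@le_trans _ _ (\sum_(k <oo) P (F k))).
  by apply: measure_sigma_subadditive => //; exact: bigcup_measurable.
by apply: lee_nneseries => // k _; exact: PF.
Qed.

End finite_intensity.
End poisson_process.

(** * Distribution of the integral of a simple function *)

Section law_of_simple_integrals.
Context {R : realType} {dO : measure_display} {Omega : measurableType dO}.
Context {P : probability Omega R} {dT : measure_display} {T : measurableType dT}.
Context {Lam : set T -> \bar R} {N : Omega -> {measure set T -> \bar R}}.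
Hypothesis HN : is_poisson_process P Lam N.
Hypothesis L0 : forall A, measurable A -> (0 <= Lam A)%E.
Hypothesis Loo : forall A, measurable A -> (Lam A < +oo)%E.
Context {k : nat} {A : 'I_k -> set T}.
Hypothesis mA : forall i, measurable (A i).
Hypothesis dA : forall i j, i != j -> A i `&` A j = set0.
Variables (v : 'I_k -> R) (t : R).
Local Open Scope ereal_scope.

(** The right-hand side mentions neither [P] nor [N], so processes with equal intensities share it.
    The event is split by the vector of counts; these vectors are numbered by [pickle], and a [j]
    that codes no vector contributes 0. *)
Lemma poisson_process_simple_law :
  P [set w | \sum_(i < k) (v i)%:E * N w (A i) <= t%:E] =
  \sum_(j <oo)
    if (pickle_inv j : option {ffun 'I_k -> nat}) is Some m then
      if (\sum_(i < k) v i * (m i)%:R <= t)%R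
      then \prod_(i < k) (poisson_p (fine (Lam (A i))) (m i))%:E else 0
    else 0.
Proof.
pose B (m : {ffun 'I_k -> nat}) :=
  \bigcap_(i in [set: 'I_k]) [set w | N w (A i) = (m i)%:R%:E].
pose F (j : nat) := if (pickle_inv j : option {ffun 'I_k -> nat}) is Some m then
  if (\sum_(i < k) v i * (m i)%:R <= t)%R then B m else set0 else set0.
pose Z := \bigcup_(i in [set: 'I_k]) [set w | N w (A i) = +oo].
set E := mkset _.
have mB m : measurable (B m).
  by apply: fin_bigcap_measurable => // i _; exact: (poisson_process_level_measurable HN).
have mF j : measurable (F j).
  by rewrite /F; case: pickle_inv => // m; case: ifP.
have mZ : measurable Z.
  by apply: fin_bigcup_measurable => // i _; exact: (poisson_process_level_measurable HN).
have mE : measurable E.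
  rewrite -[E]setTI; apply: emeasurable_fun_infty_c => //.
  apply: emeasurable_sum => i; apply: measurable_funeM.
  exact: (poisson_process_measurable HN).
have PZ : P Z = 0.
  apply/eqP; rewrite eq_le measure_ge0 andbT.
  apply: (@le_trans _ _ (\sum_(i \in [set: 'I_k]) P [set w | N w (A i) = +oo])).
    apply: content_sub_fsum => //; first exact: finite_finset.
    by move=> i _; exact: (poisson_process_level_measurable HN).
  by rewrite fsbig1// => i _; rewrite (poisson_process_infty HN) ?L0 ?Loo.
(* Where all counts are finite the vector of counts decides membership in [E]; the remaining part
   lies in the null set [Z]. *)
have EF : E = \bigcup_j F j `|` (E `&` Z).
  apply/seteqP; split => w.
    move=> Ew; have [[i _ iw]|nZ] := pselect (Z w); first by right; split => //; exists i.
    have NA i : exists n : nat, N w (A i) = n%:R%:E.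
      by case: (poisson_process_valued HN _ w (mA i)) => // Noo; case: nZ; exists i.
    have [n nE] := choice NA.
    left; exists (pickle [ffun i => n i]) => //; rewrite /F pickleK_inv.
    move: Ew; rewrite /E/=; under eq_bigr do rewrite nE -EFinM.
    rewrite sumEFin lee_fin; under [in X in _ -> X]eq_bigr do rewrite ffunE.
    by move=> ->i _ /=; rewrite ffunE.
  move=> [[j _]|[]//]; rewrite /F; case: pickle_inv => // m; case: ifP => // mt Bw.
  rewrite /E/=; under eq_bigr do rewrite (Bw _ I) -EFinM.
  by rewrite sumEFin lee_fin.
have EZ0 : P (E `&` Z) = 0.
  by apply: (subset_measure0 (B := Z)) => //; exact: measurableI.
rewrite EF measureU0//; last 2 first.
- exact: bigcup_measurable.
- exact: measurableI.
rewrite measure_bigcup//; last first.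
  apply/trivIsetP => i j _ _ ij; rewrite -subset0 => w [].
  rewrite /F.
  have := @pickle_invK {ffun 'I_k -> nat} i; have := @pickle_invK {ffun 'I_k -> nat} j.
  case: pickle_inv => [m|]//= mj; case: pickle_inv => [m'|]//= mi.
  case: ifP => // _ B'; case: ifP => // _ B''.
  move/eqP: ij; apply; rewrite -mi -mj; congr pickle; apply/ffunP => l.
  have := B' l Logic.I; rewrite /= (B'' l Logic.I) => -[] /eqP.
  by rewrite eqr_nat => /eqP.
under eq_eseriesl do rewrite in_setT.
apply: eq_eseriesr => j _; rewrite /F; case: pickle_inv => // m; case: ifP => // _.
have [_ _ _ _ HB] := HN; transitivity (\prod_(i < k) P [set w | N w (A i) = (m i)%:R%:E]).
  exact: HB k A m mA (fun i => Loo _ (mA i)) dA.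
apply: eq_bigr => i _.
by rewrite (poisson_process_pmf HN) ?L0 ?Loo.
Qed.

End law_of_simple_integrals.

Section law_of_integrals.
Context {R : realType} {dT : measure_display} {T : measurableType dT}.
Context {Lam Lam' : set T -> \bar R}.
Context {dO : measure_display} {Omega : measurableType dO}.
Context {P : probability Omega R} {N : Omega -> {measure set T -> \bar R}}.
Context {dO' : measure_display} {Omega' : measurableType dO'}.
Context {P' : probability Omega' R} {N' : Omega' -> {measure set T -> \bar R}}.
Hypothesis HN : is_poisson_process P Lam N.
Hypothesis HN' : is_poisson_process P' Lam' N'.
Hypothesis L0 : forall A, measurable A -> (0 <= Lam A)%E.
Hypothesis Loo : forall A, measurable A -> (Lam A < +oo)%E.
Hypothesis LL' : forall A, measurable A -> Lam A = Lam' A.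
Local Open Scope ereal_scope.
Import HBNNSimple.

Lemma poisson_process_nnsfun_eq_law (h : {nnsfun T >-> R}) (t : R) :
  P [set w | \int[N w]_z (h z)%:E <= t%:E] =
  P' [set w | \int[N' w]_z (h z)%:E <= t%:E].
Proof.
pose s := finmap.enum_fset (fset_set (range h)).
pose A (i : 'I_(size s)) := h @^-1` [set s`_i]%R.
have mA i : measurable (A i) by exact: measurable_sfunP.
have dA (i j : 'I_(size s)) : i != j -> A i `&` A j = set0.
  move=> ij; rewrite -subset0 => z []; rewrite /A /= => -> /eqP; rewrite nth_uniq ?finmap.fset_uniq// => ij'.
  by move: ij; rewrite -val_eqE /= ij'.
have hE (M : {measure set T -> \bar R}) :
    \int[M]_z (h z)%:E = \sum_(i < size s) (nth 0%R s i)%:E * M (A i).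
  rewrite integralT_nnsfun sintegralE fsbig_finite//=.
  by rewrite (big_nth 0%R) big_mkord.
under eq_set do rewrite hE; under [in RHS]eq_set do rewrite hE.
rewrite (poisson_process_simple_law HN)// (poisson_process_simple_law HN')//;
  try by move=> B mB; rewrite -LL' ?L0 ?Loo.
apply: eq_eseriesr => j _; case: pickle_inv => // m; case: ifP => // _.
by apply: eq_bigr => i _; rewrite LL'.
Qed.

(** With simple functions [h n] increasing to [g], the event that the integral of [g] is at most [t]
    is the decreasing intersection of the same events for [h n]; the non-strict inequality survives
    the limit. Both processes thus give limits of one and the same sequence. *)
Lemma poisson_process_integral_eq_law (g : T -> \bar R) (t : R) :
  (forall z, 0 <= g z) -> measurable_fun setT g ->
  P [set w | \int[N w]_z g z <= t%:E] = P' [set w | \int[N' w]_z g z <= t%:E].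
Proof.
move=> g0 mg; pose h := nnsfun_approx measurableT mg.
have h_le n z : (h n z)%:E <= g z.
  have hg : (h n z)%:E @[n --> \oo] --> g z by exact: cvg_nnsfun_approx.
  have /cvg_lim <- // := hg; apply: lime_ge; first by apply/cvg_ex; exists (g z).
  by near=> m; rewrite lee_fin; apply/lefP/nd_nnsfun_approx; near: m; exists n.
have H (dO1 : measure_display) (O1 : measurableType dO1) (P1 : probability O1 R)
    (N1 : O1 -> {measure set T -> \bar R}) (Lam1 : set T -> \bar R) :
    is_poisson_process P1 Lam1 N1 ->
    P1 [set w | \int[N1 w]_z (h n z)%:E <= t%:E] @[n --> \oo] -->
    P1 [set w | \int[N1 w]_z g z <= t%:E].
  move=> HN1.
  have mh n : measurable_fun [set: T] (fun z => (h n z)%:E) by exact/measurable_EFinP.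
  have ndh w : nondecreasing_seq (fun n => \int[N1 w]_z (h n z)%:E).
    move=> m n mn; apply: ge0_le_integral => //.
    - by move=> z _; rewrite lee_fin.
    - by move=> z _; rewrite lee_fin; exact/lefP/nd_nnsfun_approx.
  have intg w : \int[N1 w]_z g z = limn (fun n => \int[N1 w]_z (h n z)%:E).
    rewrite -monotone_convergence//.
    - by apply: eq_integral => z _; apply/esym/cvg_lim => //; exact: cvg_nnsfun_approx.
    - by move=> n z _; rewrite lee_fin.
    - by move=> z _ m n mn; rewrite lee_fin; exact/lefP/nd_nnsfun_approx.
  have mE n : measurable [set w | \int[N1 w]_z (h n z)%:E <= t%:E].
    rewrite -[X in measurable X]setTI; apply: emeasurable_fun_infty_c => //.
    by apply: (poisson_process_integral_measurable HN1) => // z; rewrite lee_fin.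
  have -> : [set w | \int[N1 w]_z g z <= t%:E] =
      \bigcap_n [set w | \int[N1 w]_z (h n z)%:E <= t%:E].
    apply/seteqP; split => w /=.
      move=> gt n _ /=; apply: le_trans gt; apply: ge0_le_integral => //.
      by move=> z _; rewrite lee_fin.
    move=> ht; rewrite intg; apply: lime_le.
      exact: ereal_nondecreasing_is_cvgn.
    by apply: nearW => n; exact: ht.
  apply: nonincreasing_cvg_mu => //.
  - by rewrite (le_lt_trans (probability_le1 _ _))// ltry.
  - exact: bigcap_measurable.
  - move=> m n mn; apply/subsetPset => w /=; apply: le_trans; exact: ndh.
have c := H _ _ _ _ _ HN.
rewrite (funext (fun n => poisson_process_nnsfun_eq_law (h n) t)) in c.
exact: (cvg_unique _ c (H _ _ _ _ _ HN')).
Unshelve. all: by end_near. Qed.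

End law_of_integrals.

(** * Lebesgue measure on R^d *)

Definition ocbox {R : realType} {d : nat} (a b : d.-tuple R) : set (d.-tuple R) :=
  [set x | forall i, tnth a i < tnth x i <= tnth b i].

Section boxes.
Context {R : realType} {d : nat}.
Implicit Types a b x : d.-tuple R.

Lemma measurable_forall_tnth (A : 'I_d -> set R) : (forall i, measurable (A i)) ->
  measurable [set x : d.-tuple R | forall i, A i (tnth x i)].
Proof.
move=> mA; rewrite (_ : mkset _ =
    \bigcap_(i in [set: 'I_d]) ([set: d.-tuple R] `&` (fun x => tnth x i) @^-1` A i)).
  by apply: fin_bigcap_measurable => // i _; exact: measurable_tnth.
by apply/seteqP; split => [x xA i _|x xA i]; [split => //; exact: xA|have [] := xA i Logic.I].
Qed.

Lemma measurable_ocbox a b : measurable (ocbox a b).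
Proof.
have := @measurable_forall_tnth (fun i => `]tnth a i, tnth b i]%classic).
rewrite (_ : [set x | _] = ocbox a b); first by apply.
by apply/seteqP; split => x xab i; move: (xab i); rewrite /= in_itv.
Qed.

Let boxes := [set B | exists a b, (forall i, tnth a i <= tnth b i) /\ B = ocbox a b].

Let boxes_measurable : boxes `<=` measurable.
Proof. by move=> _ [a [b [_ ->]]]; exact: measurable_ocbox. Qed.

(* Taking the maximum with c turns an empty intersection into a degenerate box. *)
Let boxesI : setI_closed boxes.
Proof.
move=> _ _ [a [b [ab ->]]] [a' [b' [ab' ->]]].
pose c := [tuple Num.max (tnth a i) (tnth a' i) | i < d].
pose e := [tuple Num.max (tnth c i) (Num.min (tnth b i) (tnth b' i)) | i < d].
exists c, e; split; first by move=> i; rewrite [leRHS]tnth_mktuple le_max lexx.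
apply/seteqP; split => x.
  move=> [xab xab'] i; rewrite !tnth_mktuple gt_max le_max le_min.
  by have /andP[-> ->] := xab i; have /andP[-> ->] := xab' i; rewrite orbT.
suff H i : tnth c i < tnth x i <= tnth e i ->
    (tnth a i < tnth x i <= tnth b i) && (tnth a' i < tnth x i <= tnth b' i).
  by move=> xce; split => i; have /H/andP[] := xce i.
rewrite !tnth_mktuple gt_max !le_max le_min => /andP[/andP[ax a'x]].
by rewrite ax a'x !leNgt ax a'x /= -!leNgt.
Qed.

Let cst_box (r : R) := ocbox [tuple - r | _ < d] [tuple r | _ < d].

Lemma bounded_coordinates x : exists n : nat, forall i, `|tnth x i| < n%:R.
Proof.
exists (Num.bound (\sum_(i < d) `|tnth x i|)) => i.
apply: le_lt_trans (archi_boundP _); last exact: sumr_ge0.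
by rewrite (bigD1 i)//= lerDl sumr_ge0.
Qed.

Lemma cst_box_cover : \bigcup_(n : nat) cst_box n%:R = setT.
Proof.
rewrite -subTset => x _; have [n xn] := bounded_coordinates x.
exists n => // i; rewrite !tnth_mktuple; have := xn i.
by rewrite ltr_norml => /andP[-> /ltW].
Qed.

(** The product sigma-algebra is generated by the coordinates, so it is enough that each half-space
    bounding one coordinate from below is a countable union of boxes. *)
Let measurable_boxes : @measurable _ (d.-tuple R) = <<s boxes >>.
Proof.
apply/seteqP; split; last exact: smallest_sub (@sigma_algebra_measurable _ _) _.
suff : measurable_fun setT (id : g_sigma_algebraType boxes -> d.-tuple R).
  by move=> mid A mA; have := mid measurableT _ mA; rewrite setTI.
apply/measurable_fun_tnthP => i.
apply: (measurability _ (RGenOInfty.measurableE R)) => _ [_ [x ->] <-].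
rewrite setTI; pose a n := [tuple if j == i then x else - n%:R | j < d].
pose b (n : nat) := [tuple if j == i then x + n%:R else n%:R | j < d].
rewrite (_ : _ @^-1` _ = \bigcup_n ocbox (a n) (b n)).
  apply: bigcupT_measurable => n; apply: sub_sigma_algebra.
  exists (a n), (b n); split => // j; rewrite !tnth_mktuple.
  by case: ifP => _; rewrite ?lerDl// lerNl (le_trans _ (ler0n _ _))// oppr_le0.
apply/seteqP; split => y /=; last first.
  by move=> [n _] /(_ i); rewrite !tnth_mktuple eqxx in_itv/= andbT => /andP[].
rewrite in_itv/= andbT => xy; have [n yn] := bounded_coordinates y.
have [m xm] : exists m : nat, `|x| < m%:R by exists (Num.bound `|x|); exact: archi_boundP.
(* The summand [n] dominates the coordinates of [y]; the summand [m] compensates a negative [x] in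
   the upper end x + n + m of side [i]. *)
exists (n + m)%N => // j; rewrite !tnth_mktuple natrD.
have := yn j; rewrite ltr_norml => /andP[y1 y2].
have := xm; rewrite ltr_norml => /andP[x1 x2].
by case: eqP => [->|_]; [rewrite xy /=; have := yn i; rewrite ltr_norml => /andP[]|]; lra.
Qed.

(** Boxes form a generating pi-system, and countably many cubes of finite measure cover the
    space. *)
Lemma measure_unique_boxes (m1 m2 : {measure set (d.-tuple R) -> \bar R}) :
  (forall a b, (forall i, tnth a i <= tnth b i) -> m1 (ocbox a b) = m2 (ocbox a b)) ->
  (forall a b, (forall i, tnth a i <= tnth b i) -> (m1 (ocbox a b) < +oo)%E) ->
  forall A, measurable A -> m1 A = m2 A.
Proof.
move=> m12 m1oo; have ab0 (n : nat) (i : 'I_d) :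
    tnth [tuple - (n%:R : R) | _ < d] i <= tnth [tuple n%:R | _ < d] i.
  by rewrite !tnth_mktuple lerNl (le_trans _ (ler0n _ _))// oppr_le0.
apply: (measure_unique boxes (fun n => cst_box n%:R)) => //.
- by move=> n; do 2 eexists; split; last reflexivity; exact: ab0.
- exact: cst_box_cover.
- by move=> _ [a [b [ab ->]]]; exact: m12.
- by move=> n; exact/m1oo/ab0.
Qed.

End boxes.

Definition dilate {R : realType} {d : nat} (c : R) (x : d.-tuple R) : d.-tuple R :=
  [tuple c * tnth x i | i < d].

Section euclidean_norm.
Context {R : realType} {d : nat}.
Implicit Types x : d.-tuple R.

Lemma measurable_dilate (c : R) : measurable_fun setT (@dilate R d c).
Proof.
apply/measurable_fun_tnthP => i.
rewrite (_ : _ \o _ = fun x : d.-tuple R => c * tnth x i).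
  by apply: measurable_funM => //; exact: measurable_tnth.
by apply/funext => x; rewrite /= tnth_mktuple.
Qed.

Lemma eucl_norm_ge0 x : 0 <= eucl_norm x.
Proof. exact: sqrtr_ge0. Qed.

Lemma eucl_norm_dilate (c : R) x : 0 <= c -> eucl_norm (dilate c x) = c * eucl_norm x.
Proof.
move=> c0; rewrite /eucl_norm; under eq_bigr do rewrite tnth_mktuple exprMn.
by rewrite -mulr_sumr sqrtrM ?sqr_ge0// sqrtr_sqr ger0_norm.
Qed.

Lemma ler_tnth_eucl_norm x i : `|tnth x i| <= eucl_norm x.
Proof.
rewrite -sqrtr_sqr ler_wsqrtr// (bigD1 i)//= lerDl.
by apply: sumr_ge0 => j _; exact: sqr_ge0.
Qed.

Lemma measurable_sqrtr_sum_sqr (f : 'I_d -> R -> R) :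
  (forall i, measurable_fun setT (f i)) ->
  measurable_fun setT (fun x : d.-tuple R => Num.sqrt (\sum_(i < d) f i (tnth x i) ^+ 2)).
Proof.
move=> mf; apply: measurableT_comp.
  by apply: continuous_measurable_fun; exact: sqrt_continuous.
apply: measurable_sum => i; apply: measurable_funX.
by apply: measurableT_comp => //; exact: measurable_tnth.
Qed.

Lemma measurable_eucl_norm : measurable_fun setT (@eucl_norm R d).
Proof. exact: (@measurable_sqrtr_sum_sqr (fun=> id)). Qed.

End euclidean_norm.

Section lebesgue_Rd.
Context {R : realType} {d : nat} {lam : {measure set (d.-tuple R) -> \bar R}}.
Hypothesis lamP : is_lebesgue_Rd lam.
Local Open Scope ereal_scope.

(** Both sides are measures in [A], a pushforward and a multiple of [lam], and they agree on boxes,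
    each of the d sides being stretched by c. *)
Lemma lebesgue_Rd_dilate (c : R) (A : set (d.-tuple R)) : (0 < c)%R -> measurable A ->
  lam (dilate c^-1 @^-1` A) = (c ^+ d)%:E * lam A.
Proof.
move=> c0 mA.
have cd0 : (0 <= c ^+ d)%R by rewrite exprn_ge0// ltW.
pose pf : {measure set (d.-tuple R) -> \bar R} := pushforward lam (dilate c^-1).
pose m1 := pf (measurable_dilate c^-1).
pose m2 : {measure set (d.-tuple R) -> \bar R} := mscale (NngNum cd0) lam.
have m1box a b : (forall i, tnth a i <= tnth b i)%R ->
    m1 (ocbox a b) = (c ^+ d * \prod_(i < d) (tnth b i - tnth a i))%:E.
  move=> ab; rewrite /m1 /= /pushforward /=.
  rewrite (_ : _ @^-1` _ = ocbox (dilate c a) (dilate c b)).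
    rewrite lamP => [|i]; last by rewrite !tnth_mktuple ler_pM2l.
    rewrite -[in X in (c ^+ X)%R](card_ord d) -prodr_const -big_split /=.
    by congr EFin; apply: eq_bigr => i _; rewrite !tnth_mktuple mulrBr.
  by apply/seteqP; split => x xab i; have := xab i;
    rewrite !tnth_mktuple ler_pdivrMl ?ltr_pdivlMl.
apply: (measure_unique_boxes m1 m2) => //.
- by move=> a b ab; rewrite m1box// /m2 /= /mscale /= [lam _]lamP// EFinM.
- by move=> a b ab; rewrite m1box// ltry.
Qed.

Definition eball (r : R) : set (d.-tuple R) := [set x | eucl_norm x <= r]%R.

Lemma measurable_eball r : measurable (eball r).
Proof.
rewrite -[eball r]setTI (_ : eball r = (@eucl_norm R d) @^-1` `]-oo, r]).
  exact: measurable_eucl_norm.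
by apply/seteqP; split => x; rewrite /= in_itv.
Qed.

Lemma lebesgue_Rd_eball r : (0 < r)%R ->
  lam (eball r) = (r ^+ d)%:E * unit_ball_volume lam.
Proof.
move=> r0; rewrite -lebesgue_Rd_dilate//; last exact: (measurable_eball 1).
congr (lam _); apply/seteqP; split => x; rewrite /eball/= eucl_norm_dilate ?invr_ge0 ?(ltW r0)//;
  by rewrite ler_pdivrMl// mulr1.
Qed.

Lemma lebesgue_Rd_bounded (r : R) (A : set (d.-tuple R)) : measurable A ->
  (forall x, A x -> forall i, `|tnth x i| <= r)%R -> lam A < +oo.
Proof.
(* Passing from r to |r| + 1 keeps the sides ordered when r is negative and moves the open lower
   faces away from [A]. *)
move=> mA Ar; have /le_lt_trans-> // : lam A <=
    lam (ocbox [tuple (- (`|r| + 1))%R | _ < d] [tuple (`|r| + 1)%R | _ < d]).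
  apply: le_measure; rewrite ?inE//; first exact: measurable_ocbox.
  move=> x /Ar xr i; rewrite !tnth_mktuple; have := xr i; rewrite ler_norml => /andP[x1 x2].
  by have := ler_norm r; move: (`|r|)%R => r' rr; apply/andP; split; lra.
rewrite lamP ?ltry// => i; rewrite !tnth_mktuple; have := normr_ge0 r.
by move: (`|r|)%R => r' r0; lra.
Qed.

Lemma unit_ball_volume_lty : unit_ball_volume lam < +oo.
Proof.
apply: (@lebesgue_Rd_bounded 1); first exact: (measurable_eball 1).
by move=> x x1 i; apply: le_trans x1; exact: ler_tnth_eucl_norm.
Qed.

Lemma unit_ball_volume_gt0 : (0 < d)%N -> 0 < unit_ball_volume lam.
Proof.
(* The cube of side q = 1/d lies in the unit ball, since its points satisfy |x|^2 <= d q^2 <= d q =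
   1. *)
move=> d0; pose q : R := (d%:R^-1)%R.
have q0 : (0 < q)%R by rewrite invr_gt0 ltr0n.
have /lt_le_trans-> // : 0 < lam (ocbox [tuple 0%R | _ < d] [tuple q | _ < d]).
  rewrite lamP; last by move=> i; rewrite !tnth_mktuple ltW.
  by rewrite lte_fin prodr_gt0// => i _; rewrite !tnth_mktuple subr0.
apply: le_measure; rewrite ?inE; first exact: measurable_ocbox.
  exact: (measurable_eball 1).
move=> x xq /=; rewrite /eucl_norm -[leRHS]sqrtr1 ler_wsqrtr//.
apply: (@le_trans _ _ (\sum_(i < d) q)%R).
  apply: ler_sum => i _; have := xq i; rewrite !tnth_mktuple => /andP[x0 xq'].
  rewrite expr2 (le_trans (ler_pM (ltW x0) (ltW x0) xq' xq'))// ler_piMl// ?(ltW q0)//.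
  by rewrite invf_le1 ?ler1n ?ltr0n.
by rewrite sumr_const card_ord -mulr_natr mulVf// pnatr_eq0 -lt0n.
Qed.

Lemma lebesgue_Rd_sigma_finite : sigma_finite setT lam.
Proof.
exists (fun n : nat => ocbox [tuple - (n%:R : R) | _ < d]%R [tuple n%:R%R | _ < d]).
  exact/esym/cst_box_cover.
move=> n; split; first exact: measurable_ocbox.
apply: (@lebesgue_Rd_bounded n%:R); first exact: measurable_ocbox.
by move=> x xn i; have := xn i; rewrite !tnth_mktuple ler_norml => /andP[/ltW-> ->].
Qed.

End lebesgue_Rd.

(** * The intensity of the marked process *)

Section marked_intensity.
Context {R : realType} {d : nat} {lam : {measure set (d.-tuple R) -> \bar R}}.
Context {mu : probability R R}.
Implicit Types (C : set (d.-tuple R * R)) (D : set (d.-tuple R)).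
Local Open Scope ereal_scope.

Lemma marked_intensityE C : marked_intensity lam setT mu C = (lam \x mu) C.
Proof.
apply: eq_integral => x _ /=; congr (mu _).
by apply/seteqP; split => r /=; rewrite /xsection/= inE.
Qed.

Lemma marked_intensity_restr D C :
  marked_intensity lam D mu C = marked_intensity lam setT mu (C `&` (D `*` setT)).
Proof.
rewrite /marked_intensity integral_mkcond; apply: eq_integral => x _.
rewrite patchE; case: ifPn => [/set_mem Dx|/negP nDx].
  by congr (mu _); apply/seteqP; split => [r Cxr|r []//]; split.
rewrite (_ : mkset _ = set0) ?measure0// -subset0 => r [_ [Dx _]].
by apply: nDx; rewrite inE.
Qed.

Lemma marked_intensity_fubini C : sigma_finite setT lam -> measurable C ->
  marked_intensity lam setT mu C = \int[mu]_r lam [set x | C (x, r)].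
Proof.
move=> sf mC.
(* Tonelli's theorem is stated for bundled sigma-finite measures, so [lam] is repackaged with the
   proof [sf]. *)
pose H1 := isSigmaFinite.Build _ _ _ _ sf.
pose H2 := isSFinite.Build _ _ _ _ (sfinite_measure_sigma_finite sf).
pose lam' := HB.pack_for (SigmaFiniteMeasure.type (d.-tuple R) R) (Measure.sort lam) H1 H2.
have lamE : lam = lam' by exact: eq_measure.
rewrite marked_intensityE lamE.
have := indic_fubini_tonelli lam' mu mC.
rewrite (indic_fubini_tonelli_FE mu mC) (indic_fubini_tonelli_GE lam' mC) => CE.
rewrite [LHS]CE; apply: eq_integral => r _ /=; congr (lam' _).
by apply/seteqP; split => x /=; rewrite /ysection/= inE.
Qed.

End marked_intensity.

Section reach.
Context {R : realType} {d : nat}.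
Implicit Types z : d.-tuple R * R.

Definition reach : set (d.-tuple R * R) := [set z | eucl_norm z.1 <= z.2].

Definition reach_beyond (rho : R) : set (d.-tuple R * R) :=
  [set z | eucl_norm z.1 <= z.2 /\ rho < eucl_norm z.1].

Let measurable_norm1 : measurable_fun setT (fun z => eucl_norm z.1).
Proof. by apply: measurableT_comp => //; exact: measurable_eucl_norm. Qed.

Lemma measurable_reach : measurable reach.
Proof.
have /(_ measurableT [set true]) := @measurable_fun_ler _ _ _ _ _ _ measurable_norm1
  (@measurable_snd _ _ (d.-tuple R) R).
by rewrite setTI; apply.
Qed.

Lemma measurable_reach_beyond rho : measurable (reach_beyond rho).
Proof.
apply: measurableI; first exact: measurable_reach.
have /(_ measurableT [set true]) := @measurable_fun_ltr _ _ _ _ _ _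
  (@measurable_cst _ _ (d.-tuple R * R)%type R setT rho) measurable_norm1.
by rewrite setTI; apply.
Qed.

End reach.

Section reach_intensity.
Context {R : realType} {d : nat} {lam : {measure set (d.-tuple R) -> \bar R}}.
Context {mu : probability R R}.
Hypotheses (lamP : is_lebesgue_Rd lam) (d0 : (0 < d)%N).
Local Open Scope ereal_scope.

Local Notation kappa := (unit_ball_volume lam).
Local Notation Lam := (marked_intensity lam setT mu).

Lemma unit_ball_volume_fin_num : kappa \is a fin_num.
Proof. by rewrite ge0_fin_numE ?measure_ge0// unit_ball_volume_lty. Qed.

(* A ball of radius 0 is its own dilate, so its measure v satisfies v = 2^d v. *)
Lemma lebesgue_Rd_eball0 : lam (eball 0) = 0.
Proof.
have := @lebesgue_Rd_dilate _ _ _ lamP 2%R (eball 0) (ltr0Sn _ _) (measurable_eball 0).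
rewrite (_ : _ @^-1` _ = eball 0); last first.
  apply/seteqP; split => x; rewrite /eball/= eucl_norm_dilate ?invr_ge0//.
    by rewrite pmulr_rle0 ?invr_gt0.
  by rewrite pmulr_rle0 ?invr_gt0.
have : lam (eball 0) \is a fin_num.
  rewrite ge0_fin_numE ?measure_ge0//.
  apply: (@lebesgue_Rd_bounded _ _ _ lamP 0); first exact: measurable_eball.
  by move=> x x0 i; apply: le_trans x0; exact: ler_tnth_eucl_norm.
move=> /fineK <-; rewrite -EFinM => -[] /eqP; rewrite -subr_eq0 -{1}[fine _]mul1r.
rewrite -mulrBl mulf_eq0 => /orP[|/eqP->//]; rewrite subr_eq0 eq_sym.
by rewrite gt_eqF// exprn_egt1 -?lt0n// ltr1n.
Qed.

Lemma lebesgue_Rd_eball_ge0 r : (0 <= r)%R -> lam (eball r) = (r ^+ d)%:E * kappa.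
Proof.
rewrite le_eqVlt => /orP[/eqP<-|]; last exact: lebesgue_Rd_eball.
by rewrite lebesgue_Rd_eball0 expr0n eqn0Ngt d0 mul0e.
Qed.

(** The section at mark [r] is the ball of radius [r], empty for r < 0. The positive part is taken
    because [r ^+ d] need not vanish there. *)
Lemma reach_intensity :
  Lam reach = kappa * \int[mu]_r ((Num.max 0 r) ^+ d)%:E.
Proof.
rewrite marked_intensity_fubini; [|exact: lebesgue_Rd_sigma_finite|exact: measurable_reach].
rewrite -ge0_integralZl ?measure_ge0//; last 2 first.
- by apply/measurable_EFinP; apply: measurable_funX; exact: measurable_maxr.
- by move=> r _; rewrite lee_fin exprn_ge0// le_max lexx.
apply: eq_integral => r _ /=; have [r0|r0] := ltP r 0%R.
  rewrite expr0n eqn0Ngt d0 mule0.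
  rewrite (_ : mkset _ = set0) ?measure0// -subset0 => x /= xr.
  by have := le_lt_trans xr r0; rewrite ltNge eucl_norm_ge0.
by rewrite [LHS](lebesgue_Rd_eball_ge0 _ r0) muleC.
Qed.

(** The section at mark [r] is the shell between the balls of radii [rho] and [r], empty when r <=
    rho; its volume is a difference because both balls have finite volume. *)
Lemma reach_beyond_intensity rho : (0 <= rho)%R ->
  Lam (reach_beyond rho) =
  kappa * \int[mu]_r (Num.max 0 ((Num.max 0 r) ^+ d - rho ^+ d))%:E.
Proof.
move=> rho0; rewrite marked_intensity_fubini; [|exact: lebesgue_Rd_sigma_finite|exact: measurable_reach_beyond].
rewrite -ge0_integralZl ?measure_ge0//; last 2 first.
- apply/measurable_EFinP; apply: measurable_maxr => //; apply: measurable_funB => //.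
  by apply: measurable_funX; exact: measurable_maxr.
- by move=> r _; rewrite lee_fin le_max lexx.
apply: eq_integral => r _ /=; have [r0|r0] := leP r rho.
  rewrite (max_idPl _); last first.
    by rewrite subr_le0 ler_pXn2r// ?nnegrE ?le_max ?lexx// ge_max rho0.
  rewrite mule0 (_ : mkset _ = set0) ?measure0// -subset0 => x /= [xr xrho].
  by have := lt_le_trans xrho (le_trans xr r0); rewrite ltxx.
have r0' := le_trans rho0 (ltW r0).
rewrite (_ : [set x | _] = eball r `\` eball rho); last first.
  apply/seteqP; split => x /=; first by move=> [xr xrho]; split => //; apply/negP; rewrite -ltNge.
  by move=> [xr /negP]; rewrite -ltNge.
have rhor : (eball rho : set (d.-tuple R)) `<=` eball r by move=> x /le_trans; apply; exact: ltW.
have lamoo : lam (eball r) < +oo.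
  rewrite lebesgue_Rd_eball_ge0// -ge0_fin_numE.
    by rewrite fin_numM ?unit_ball_volume_fin_num.
  by rewrite mule_ge0 ?lee_fin ?exprn_ge0 ?measure_ge0.
transitivity (lam (eball r) - lam (eball rho)).
  rewrite measureD//; try exact: measurable_eball.
  by rewrite setIidr.
rewrite !lebesgue_Rd_eball_ge0// -muleBl ?unit_ball_volume_fin_num//.
rewrite (max_idPr r0') (max_idPr _) ?subr_ge0 ?ler_pXn2r ?nnegrE ?(ltW r0)//.
by rewrite muleC EFinB.
Qed.

End reach_intensity.

(** * Tail of the mark distribution *)

Section powR_at_infinity.
Context {R : realType}.

Lemma cvgy_powR (p : R) : 0 < p -> t `^ p @[t --> +oo] --> +oo.
Proof.
move=> p0; apply/cvgryPge => A; near=> t.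
have A0 : 0 <= Num.max 0 A by rewrite le_max lexx.
apply: (@le_trans _ _ (Num.max 0 A)); first by rewrite le_max lexx orbT.
rewrite -[leLHS]powRr1// -(mulVf (lt0r_neq0 p0)) powRrM.
by rewrite ge0_ler_powR ?nnegrE ?powR_ge0 ?(ltW p0)//; near: t; exact: nbhs_pinfty_ge.
Unshelve. all: by end_near. Qed.

Lemma cvgy_powRN {T : Type} {F : set_system T} {FF : Filter F} (f : T -> R) (p : R) :
  0 < p -> f x @[x --> F] --> +oo -> f x `^ (- p) @[x --> F] --> 0.
Proof.
move=> p0 fy; under eq_cvg do rewrite powRN.
have fpy : f x `^ p @[x --> F] --> +oo.
  by apply: (cvg_comp f (fun t => t `^ p) fy); exact: cvgy_powR.
have fp0 : \forall x \near F, 0 < f x `^ p.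
  by near=> x; rewrite powR_gt0//; near: x; exact: (cvgry_gt fy 0).
exact: (gtr0_cvgV0 fp0).2.
Unshelve. all: by end_near. Qed.

Lemma is_derive_powR_shift (c q y : R) : 0 < c -> 0 <= y ->
  is_derive y 1 (fun x => (c + x) `^ q) (q * (c + y) `^ (q - 1)).
Proof.
move=> c0 y0; rewrite -[X in is_derive _ _ _ X]mulr1.
have h1 : is_derive y 1 (fun x => c + x) 1.
  by rewrite -[X in is_derive _ _ _ X]add0r; exact: is_deriveD.
have h2 : is_derive (c + y) 1 (fun x : R => x `^ q) (q * (c + y) `^ (q - 1)).
  by apply: is_derive1_powR; rewrite ltr_wpDr.
exact: (@is_derive1_comp _ (fun x : R => x `^ q) (fun x => c + x) y).
Qed.

Lemma continuous_powR_shift (c q y : R) : 0 < c -> 0 <= y ->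
  {for y, continuous (fun x => (c + x) `^ q)}.
Proof.
move=> c0 y0; apply: differentiable_continuous; apply/derivable1_diffP.
by have [] := is_derive_powR_shift c q y c0 y0.
Qed.

Lemma integral_powR_shift (c p : R) : 0 < c -> 0 < p ->
  (\int[lebesgue_measure]_(y in `[0%R, +oo[) ((c + y) `^ (- (p + 1)))%:E =
   (c `^ (- p) / p)%:E)%E.
Proof.
move=> c0 p0.
pose F (y : R) : R := - p^-1 * (c + y) `^ (- p).
have dF (y : R) : 0 <= y -> is_derive y 1 F ((c + y) `^ (- (p + 1))).
  move=> y0; have := is_derive_powR_shift c (- p) y c0 y0 => h.
  have -> : (c + y) `^ (- (p + 1)) = - p^-1 *: (- p * (c + y) `^ (- p - 1)).
    by rewrite /GRing.scale/= mulrA mulrNN mulVf ?mul1r ?opprD// lt0r_neq0.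
  exact: is_deriveZ.
have cF : F x @[x --> 0^'+] --> F 0.
  apply/cvg_at_right_filter; apply: differentiable_continuous; apply/derivable1_diffP.
  by have [] := dF 0 (lexx 0).
rewrite (@ge0_continuous_FTC2y _ _ F _ 0) ?sub0e//.
- by rewrite /F addr0 -EFinN mulNr opprK mulrC.
- by move=> y _; exact: powR_ge0.
- apply/continuous_within_itvcyP; split.
    move=> y; rewrite in_itv/= andbT => /ltW y0; exact: continuous_powR_shift.
  by apply/cvg_at_right_filter; exact: continuous_powR_shift.
- rewrite -[X in _ --> X](mulr0 (- p^-1)); apply: cvgMl_tmp; apply: cvgy_powRN => //.
  by apply/cvgryPge => A; near=> x; rewrite -lerBlDl; near: x;
    exact: (nbhs_pinfty_ge (num_real (A - c))).
- by move=> y /ltW/dF[].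
- by move=> y; rewrite in_itv/= andbT => /ltW /dF d; rewrite derive1E derive_val.
Unshelve. all: by end_near. Qed.
End powR_at_infinity.

(** * Asymptotics of the moment E[(R^d - rho^d)_+] *)

Section excess_moment.
Context {R : realType} {mu : probability R R} {d : nat}.
Hypothesis d0 : (0 < d)%N.

Definition excess (rho r : R) : R := Num.max 0 (Num.max 0 r ^+ d - rho ^+ d).

Let dR0 : 0 < d%:R :> R. Proof. by rewrite ltr0n. Qed.

Lemma excess_ge0 rho r : 0 <= excess rho r.
Proof. by rewrite le_max lexx. Qed.

Lemma measurable_excess rho : measurable_fun setT (excess rho).
Proof.
apply: measurable_maxr => //; apply: measurable_funB => //.
by apply: measurable_funX; exact: measurable_maxr.
Qed.

Lemma excess_gt rho y r : 0 <= rho -> 0 <= y ->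
  (y < excess rho r) = ((rho ^+ d + y) `^ d%:R^-1 < r).
Proof.
move=> rho0 y0; have c0 : 0 <= rho ^+ d + y by rewrite addr_ge0 ?exprn_ge0.
rewrite /excess lt_max ltNge y0 /= ltrBrDl.
have m0 : 0 <= Num.max 0 r by rewrite le_max lexx.
transitivity ((rho ^+ d + y) `^ d%:R^-1 < Num.max 0 r); last first.
  by rewrite lt_max ltNge powR_ge0.
rewrite -(@powR_mulrn _ (Num.max 0 r))//.
apply/idP/idP => [h|h].
  have := @gt0_ltr_powR R d%:R^-1 _ _ _ _ _ h.
  rewrite -powRrM divff ?lt0r_neq0// powRr1//.
  by apply; rewrite ?invr_gt0// nnegrE ?powR_ge0.
have := @gt0_ltr_powR R d%:R dR0 _ _ _ _ h.
rewrite -powRrM mulVf ?lt0r_neq0// powRr1//.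
by apply; rewrite nnegrE ?powR_ge0.
Qed.

(** [excess rho] is a random variable on the space of marks itself, and [excess_gt] rewrites its
    superlevel sets as half-lines of marks. *)
Lemma excess_layer_cake rho : 0 <= rho ->
  (\int[mu]_r (excess rho r)%:E =
   \int[lebesgue_measure]_(y in `[0%R, +oo[)
     mu [set` `](rho ^+ d + y) `^ d%:R^-1, +oo[%R])%E.
Proof.
move=> rho0.
pose X : {RV mu >-> R} :=
  HB.pack (excess rho) (isMeasurableFun.Build _ _ _ _ _ (measurable_excess rho)).
have := @ge0_expectation_ccdf _ _ _ mu X (excess_ge0 rho).
rewrite unlock => ->; apply: eq_integral => y; rewrite inE/= in_itv/= andbT => y0.
rewrite /ccdf /distribution /pushforward; congr (mu _).
by apply/seteqP; split => r /=; rewrite !in_itv/= !andbT excess_gt.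
Qed.

Context {s beta : R}.
Hypotheses (ds : d%:R < s) (beta0 : 0 < beta).
Hypothesis tail_mu :
  (fun h => h `^ s * fine (mu [set` `]h, +oo[%R])) x @[x --> +oo] --> beta.

Local Notation gamma := (s - d%:R).
Let gamma0 : 0 < gamma. Proof. by rewrite subr_gt0. Qed.

(** Every threshold h = (rho^d + y)^(1/d) is at least [rho], so one large [rho] makes h^s P(R > h)
    within [e] of [beta] for all y >= 0 at once. The power h^(-s) then integrates exactly. The bound
    e <= beta keeps the lower integrand nonnegative. *)
Lemma excess_moment_bounds (e : R) : 0 < e <= beta -> \forall rho \near +oo,
  (((beta - e) * (rho `^ (- gamma) * (d%:R / gamma)))%:E <=
   \int[mu]_r (excess rho r)%:E <=
   ((beta + e) * (rho `^ (- gamma) * (d%:R / gamma)))%:E)%E.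
Proof.
move=> /andP[e0 eb].
have [M [_ HM]] : \forall h \near +oo, `|beta - h `^ s * fine (mu [set` `]h, +oo[%R])| <= e.
  by move: tail_mu => /cvgrPdist_le; apply.
near=> rho.
have rho0 : 0 < rho by near: rho; exact: (nbhs_pinfty_gt (num_real 0)).
have rhoM : M < rho by near: rho; exact: (nbhs_pinfty_gt (num_real M)).
have c0 : 0 < rho ^+ d by rewrite exprn_gt0.
(* With this [p], p + 1 = s / d, hence (rho^d + y)^(-(p + 1)) = h^(-s), and the integral over y is
   rho^(-d p) / p = rho^(-gamma) d / gamma. *)
pose p := gamma / d%:R.
have p0 : 0 < p by rewrite divr_gt0.
have mpow : measurable_fun setT (fun y : measurableTypeR R => ((rho ^+ d + y) `^ (- (p + 1)))%:E).
  apply/measurable_EFinP.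
  have mf : measurable_fun setT (fun y : measurableTypeR R => rho ^+ d + y) by exact: measurable_funD.
  exact: (measurableT_comp (measurable_powR (- (p + 1))) mf).
have Ip (b : R) : 0 <= b ->
    ((b * (rho `^ (- gamma) * (d%:R / gamma)))%:E =
    \int[lebesgue_measure]_(y in `[0%R, +oo[) (b * (rho ^+ d + y) `^ (- (p + 1)))%:E)%E.
  move=> b0; under eq_integral do rewrite EFinM.
  rewrite ge0_integralZl//=.
  - rewrite integral_powR_shift// EFinM; congr (_ * _)%E; congr EFin.
    rewrite -(powR_mulrn _ (ltW rho0)) -powRrM mulrN.
    by rewrite (_ : d%:R * p = gamma) /p ?invf_div// mulrC divfK// lt0r_neq0.
  - by apply: measurable_funTS; exact: mpow.
  - by move=> y _; rewrite lee_fin powR_ge0.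
have bnd (y : R) : 0 <= y ->
    (beta - e) * (rho ^+ d + y) `^ (- (p + 1)) <=
    fine (mu [set` `](rho ^+ d + y) `^ d%:R^-1, +oo[%R]) <=
    (beta + e) * (rho ^+ d + y) `^ (- (p + 1)).
  move=> y0; set h := (rho ^+ d + y) `^ d%:R^-1.
  have cy0 : 0 < rho ^+ d + y by rewrite ltr_wpDr.
  have h0 : 0 < h by rewrite powR_gt0.
  have -> : (rho ^+ d + y) `^ (- (p + 1)) = (h `^ s)^-1.
    rewrite -powRN -powRrM; congr (_ `^ _).
    by rewrite /p mulrN; congr (- _); field; rewrite lt0r_neq0.
  have rhoh : rho <= h.
    rewrite -[leLHS](powRr1 (ltW rho0)) -(divff (lt0r_neq0 dR0)) powRrM.
    rewrite ge0_ler_powR ?invr_ge0 ?nnegrE ?powR_ge0 ?(ltW dR0) ?(ltW cy0)//.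
    by rewrite powR_mulrn ?(ltW rho0)// lerDl.
  have hs : 0 < h `^ s by rewrite powR_gt0.
  have := HM h (lt_le_trans rhoM rhoh).
  rewrite ler_pdivrMr// ler_pdivlMr// ![fine _ * _]mulrC ler_distlC.
  by move=> /andP[-> ->].
rewrite excess_layer_cake ?(ltW rho0)//.
have mmu : measurable_fun (`[0%R, +oo[ : set R)
    (fun y : R => mu [set` `](rho ^+ d + y) `^ d%:R^-1, +oo[%R]).
  pose X : {RV mu >-> R} :=
    HB.pack (id : R -> R) (isMeasurableFun.Build _ _ _ _ (id : R -> R) (@measurable_id _ _ setT)).
  have mc : measurable_fun setT (ccdf X) by exact: ccdf_measurable.
  have mg : measurable_fun setT (fun y : measurableTypeR R => (rho ^+ d + y) `^ d%:R^-1).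
    have mf : measurable_fun setT (fun y : measurableTypeR R => rho ^+ d + y) by exact: measurable_funD.
    exact: (measurableT_comp (measurable_powR d%:R^-1) mf).
  by apply: measurable_funTS; exact: (measurableT_comp mc mg).
have mb (b : R) : measurable_fun (`[0%R, +oo[ : set R)
    (fun y : measurableTypeR R => (b * (rho ^+ d + y) `^ (- (p + 1)))%:E).
  apply: measurable_funTS; apply/measurable_EFinP; apply: measurable_funM => //.
  exact/measurable_EFinP.
have ge0_in (y : R) : y \in `[0%R, +oo[ -> 0 <= y by rewrite in_itv/= andbT.
apply/andP; split; rewrite Ip ?subr_ge0 ?addr_ge0 ?(ltW e0) ?(ltW beta0)//;
  apply: ge0_le_integral => //=.
- by move=> y _; rewrite lee_fin mulr_ge0 ?powR_ge0 ?subr_ge0.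
- exact: mb.
- move=> y /ge0_in y0; rewrite -[leRHS]fineK ?fin_num_measure// lee_fin.
  by have /andP[] := bnd y y0.
- exact: mb.
- move=> y /ge0_in y0; rewrite -[leLHS]fineK ?fin_num_measure// lee_fin.
  by have /andP[] := bnd y y0.
Unshelve. all: by end_near. Qed.

(** For one large [rho] the excess has finite mean by [excess_moment_bounds], and the positive part
    to the power d is at most the excess plus rho^d. *)
Lemma positive_part_moment_lty : (\int[mu]_r ((Num.max 0 r) ^+ d)%:E < +oo)%E.
Proof.
have be : 0 < beta <= beta by rewrite beta0 /=.
near (+oo : set_system R) => rho.
have /andP[_ ub] : (((beta - beta) * (rho `^ (- gamma) * (d%:R / gamma)))%:E <=
   \int[mu]_r (excess rho r)%:E <=
   ((beta + beta) * (rho `^ (- gamma) * (d%:R / gamma)))%:E)%E.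
  by near: rho; exact: excess_moment_bounds.
apply: (@le_lt_trans _ _ (\int[mu]_r ((excess rho r)%:E + (rho ^+ d)%:E))%E).
  apply: ge0_le_integral => //=.
  - by move=> r _; rewrite lee_fin exprn_ge0// le_max lexx.
  - by apply/measurable_EFinP; apply: measurable_funX; exact: measurable_maxr.
  - apply: emeasurable_funD => //.
    by apply/measurable_EFinP; exact: measurable_excess.
  by move=> r _; rewrite -EFinD lee_fin /excess -lerBlDr le_max lexx orbT.
have rho0 : 0 < rho by near: rho; exact: (nbhs_pinfty_gt (num_real 0)).
rewrite ge0_integralD//=; last 3 first.
- by move=> r _; rewrite lee_fin excess_ge0.
- by apply/measurable_EFinP; exact: measurable_excess.
- by move=> r _; rewrite lee_fin exprn_ge0 ?(ltW rho0).
rewrite integral_cst//= probability_setT mule1 lte_add_pinfty ?ltry//.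
exact: le_lt_trans ub (ltry _).
Unshelve. all: by end_near. Qed.

Lemma excess_moment_fin_num rho : 0 <= rho ->
  (\int[mu]_r (excess rho r)%:E)%E \is a fin_num.
Proof.
move=> rho0; rewrite ge0_fin_numE; last first.
  by apply: integral_ge0 => r _; rewrite lee_fin excess_ge0.
apply: le_lt_trans positive_part_moment_lty; apply: ge0_le_integral => //=.
- by move=> r _; rewrite lee_fin excess_ge0.
- by apply/measurable_EFinP; exact: measurable_excess.
- by apply/measurable_EFinP; apply: measurable_funX; exact: measurable_maxr.
move=> r _; have m0 : 0 <= Num.max 0 r by rewrite le_max lexx.
by rewrite lee_fin /excess ge_max exprn_ge0// gerBl exprn_ge0.
Qed.

Lemma excess_moment_asymptotics :
  (fun rho => rho `^ gamma * fine (\int[mu]_r (excess rho r)%:E)%E) x @[x --> +oo]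
  --> d%:R * beta / gamma.
Proof.
pose K := d%:R / gamma.
have K0 : 0 < K by rewrite divr_gt0.
apply/cvgrPdist_le => e e0.
(* The first term makes e' K <= e; the second makes [excess_moment_bounds] applicable. *)
pose e' := Num.min (e / K) beta.
have e'P : 0 < e' <= beta by rewrite lt_min beta0 divr_gt0// ge_min lexx orbT.
near=> rho.
have rho0 : 0 < rho by near: rho; exact: (nbhs_pinfty_gt (num_real 0)).
have /andP[lb ub] : (((beta - e') * (rho `^ (- gamma) * K))%:E <=
   \int[mu]_r (excess rho r)%:E <= ((beta + e') * (rho `^ (- gamma) * K))%:E)%E.
  by near: rho; exact: excess_moment_bounds.
have Ifin := excess_moment_fin_num rho (ltW rho0).
move: lb ub; rewrite -(fineK Ifin) !lee_fin /= powRN => lb ub.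
have rg0 : 0 < rho `^ gamma by rewrite powR_gt0.
have eK : e' * K <= e by rewrite -ler_pdivlMr// ge_min lexx.
rewrite mulrAC -/K ler_distlC; apply/andP; split.
  apply: (@le_trans _ _ (rho `^ gamma * ((beta - e') * ((rho `^ gamma)^-1 * K)))).
    rewrite mulrCA mulVKf ?lt0r_neq0//; nra.
  by rewrite ler_pM2l.
apply: (@le_trans _ _ (rho `^ gamma * ((beta + e') * ((rho `^ gamma)^-1 * K)))).
  by rewrite ler_pM2l.
rewrite mulrCA mulVKf ?lt0r_neq0//; nra.
Unshelve. all: by end_near. Qed.

End excess_moment.

(** * Compound Poisson tails *)

Section counting_measure_integrals.
Context {R : realType} {dT : measure_display} {T : measurableType dT}.
Context {M : {measure set T -> \bar R}} {f : T -> R}.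
Hypotheses (f0 : forall z, 0 <= f z) (mf : measurable_fun setT f).

Lemma measurable_superlevel (t : R) : measurable [set z | t < f z].
Proof.
rewrite -[X in measurable X]setTI -preimage_itvoy.
exact: mf.
Qed.

(** By countable subadditivity some set where f > t + 1/(n+1) is already charged. Its mass is
    integral or infinite, hence at least 1, and the margin 1/(n+1) gives the strict inequality. *)
Lemma integral_gt_superlevel (t : R) : 0 <= t ->
  (forall A, measurable A -> M A = +oo \/ exists k : nat, M A = k%:R%:E)%E ->
  (M [set z | (t < f z)%R] != 0 -> t%:E < \int[M]_z (f z)%:E)%E.
Proof.
move=> t0 MN MA.
pose A n := [set z | t + n.+1%:R^-1 < f z].
have mA n : measurable (A n) by exact: measurable_superlevel.
have [n An] : exists n, M (A n) != 0%E.
  apply: contrapT => /forallNP nA; move/eqP: MA; apply; apply/eqP.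
  rewrite eq_le measure_ge0 andbT.
  apply: (@le_trans _ _ (\sum_(n <oo) M (A n))%E).
    apply: measure_sigma_subadditive => //; first exact: measurable_superlevel.
    move=> z /= tfz; have e0 : 0 < f z - t by rewrite subr_gt0.
    have [n ne] := ltr_add_invr tfz; exists n => //.
  by rewrite eseries0// => n _ _; apply/eqP/negPn/negP; exact: nA.
have MA1 : (1%:E <= M (A n))%E.
  case: (MN (A n) (mA n)) => [->|[k kE]]; first by rewrite leey.
  by move: An; rewrite kE lee_fin eqe pnatr_eq0 ler1n lt0n.
have tn0 : 0 < t + n.+1%:R^-1 by rewrite ltr_wpDl// invr_gt0.
apply: (@lt_le_trans _ _ (t + n.+1%:R^-1)%:E); first by rewrite lte_fin ltrDl invr_gt0.
apply: (@le_trans _ _ ((t + n.+1%:R^-1)%:E * M (A n))%E).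
  by rewrite -[leLHS]mule1 lee_pmul2l// lte_fin.
rewrite -integral_cst//.
apply: (@le_trans _ _ (\int[M]_(z in A n) (f z)%:E)%E).
  apply: ge0_le_integral => //.
  - by move=> z _; rewrite lee_fin ltW.
  - by apply/measurable_EFinP; exact: measurable_funTS.
  - by move=> z /ltW; rewrite lee_fin.
apply: ge0_subset_integral => //; first exact/measurable_EFinP.
by move=> z _; rewrite lee_fin.
Qed.

(** Off a null set [f] is at most [u] where it exceeds [x], and at most [x] elsewhere on its
    support. It is therefore dominated by the function [g] below, whose integral is at most u + x
    K. *)
Lemma integral_le_superlevel (t u x K : R) : 0 <= u -> 0 <= x -> u + x * K <= t ->
  (M [set z | (u < f z)%R] = 0 -> M [set z | (x < f z)%R] <= 1 ->
   M [set z | (0 < f z)%R] <= K%:E -> \int[M]_z (f z)%:E <= t%:E)%E.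
Proof.
move=> u0 x0 ut Mu Mx M0.
have mEf : measurable_fun setT (fun z => (f z)%:E) by exact/measurable_EFinP.
rewrite (ge0_negligible_integral (measurable_superlevel u))//; last first.
  by move=> z _; rewrite lee_fin.
pose g z := (u%:E * (\1_[set z | (x < f z)%R] z)%:E + x%:E * (\1_[set z | (0 < f z)%R] z)%:E)%E.
have mi (v y : R) : measurable_fun setT (fun z => y%:E * (\1_[set z | (v < f z)%R] z)%:E)%E.
  apply: measurable_funeM; apply/measurable_EFinP; apply: measurable_indic.
  exact: measurable_superlevel.
have i0 (v y : R) z : 0 <= y -> (0 <= y%:E * (\1_[set z | (v < f z)%R] z)%:E)%E.
  by move=> y0; rewrite mule_ge0.
have mD : measurable ([set: T] `\` [set z | u < f z]).
  by apply: measurableD => //; exact: measurable_superlevel.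
apply: (@le_trans _ _ (\int[M]_z g z)%E).
  apply: (@le_trans _ _ (\int[M]_(z in [set: T] `\` [set z | (u < f z)%R]) g z)%E).
    apply: ge0_le_integral => //.
    - by move=> z _; rewrite lee_fin.
    - exact: measurable_funTS.
    - by apply: measurable_funTS; apply: emeasurable_funD.
    - move=> z [_ /= /negP]; rewrite -leNgt => fu.
      rewrite /g -!EFinM -EFinD lee_fin !indicE.
      case: (ltP x (f z)) => xf.
        rewrite mem_set//= mulr1; apply: le_trans fu _.
        by rewrite lerDl mulr_ge0.
      rewrite memNset/=; last by rewrite ltNge xf.
      rewrite mulr0 add0r; case: (ltP 0 (f z)) => zf.
        by rewrite mem_set//= mulr1.
      by rewrite memNset/= ?mulr0//; last by rewrite ltNge zf.
  apply: ge0_subset_integral => //; first exact: emeasurable_funD.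
  by move=> z _; rewrite adde_ge0 ?i0.
rewrite ge0_integralD//; [|by move=> z _; exact: i0|by move=> z _; exact: i0].
rewrite !ge0_integralZl ?lee_fin//; try (apply/measurable_EFinP; apply: measurable_indic;
  exact: measurable_superlevel).
rewrite !integral_indic ?setIT//; try exact: measurable_superlevel.
apply: (@le_trans _ _ (u%:E * 1 + x%:E * K%:E)%E); last by rewrite mule1 -EFinM -EFinD lee_fin.
by apply: leeD; apply: lee_wpmul2l; rewrite ?lee_fin.
Qed.

End counting_measure_integrals.

Section compound_poisson_tail.
Context {R : realType} {dO : measure_display} {Omega : measurableType dO}.
Context {P : probability Omega R} {dT : measure_display} {T : measurableType dT}.
Context {Lam : {measure set T -> \bar R}} {N : Omega -> {measure set T -> \bar R}}.
Hypothesis HN : is_poisson_process P Lam N.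
Context {f : T -> R}.
Hypotheses (f0 : forall z, 0 <= f z) (mf : measurable_fun setT f).
Hypothesis Lf : (Lam [set z | (0 < f z)%R] < +oo)%E.

Local Notation G v := (fine (Lam [set z | (v < f z)%R])).
Local Notation tail t := [set w | (t%:E < \int[N w]_z (f z)%:E)%E].

Let mS v : measurable [set z | v < f z]. Proof. exact: measurable_superlevel. Qed.

Let GE v : 0 <= v -> (Lam [set z | (v < f z)%R] < +oo)%E.
Proof.
move=> v0; apply: le_lt_trans Lf; apply: le_measure; rewrite ?inE//.
by move=> z /=; exact: le_lt_trans.
Qed.

Let G0 v : 0 <= G v. Proof. exact: fine_ge0. Qed.

Let mtail t : measurable (tail t).
Proof.
rewrite -[X in measurable X]setTI; apply: emeasurable_fun_o_infty => //.
apply: (poisson_process_integral_measurable HN) => [z|]; first by rewrite lee_fin.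
exact/measurable_EFinP.
Qed.

Let mN v : measurable_fun setT (fun w => N w [set z | v < f z]).
Proof. exact: (poisson_process_measurable HN). Qed.

(** A single point with f > t suffices, and the left-hand side is the probability that one
    exists. *)
Lemma compound_poisson_tail_ge t : 0 <= t -> 1 - expR (- G t) <= fine (P (tail t)).
Proof.
move=> t0; rewrite -lee_fin fineK ?fin_num_measure//.
rewrite -(poisson_process_ge1 HN) ?GE//; apply: le_measure; rewrite ?inE//.
  rewrite (_ : mkset _ = ~` [set w | N w [set z | t < f z] = 0%E]).
    by apply: measurableC; exact: (poisson_process_level_measurable HN).
  by apply/seteqP; split => w /= /eqP.
move=> w /=; apply: integral_gt_superlevel => // A mA.
exact: (poisson_process_valued HN).
Qed.

(** A sum above [t] forces a jump above [u], more than [K] jumps, or two jumps above [x]; the three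
    terms bound these probabilities in that order. *)
Lemma compound_poisson_tail_le t u x K : 0 <= u -> 0 <= x -> u + x * K <= t ->
  fine (P (tail t)) <= G u + expR (G 0 * expR 1 - G 0 - K) + G x ^+ 2.
Proof.
move=> u0 x0 ut; rewrite -lee_fin fineK ?fin_num_measure//.
pose E1 := [set w | N w [set z | u < f z] != 0%E].
pose E2 := [set w | (K%:E < N w [set z | (0 < f z)%R])%E].
pose E3 := [set w | N w [set z | x < f z] != 0%E /\ N w [set z | x < f z] != 1%E].
have mne v (y : \bar R) : measurable [set w | N w [set z | v < f z] != y].
  rewrite (_ : mkset _ = ~` [set w | N w [set z | v < f z] = y]).
    by apply: measurableC; exact: (poisson_process_level_measurable HN).
  by apply/seteqP; split => w /= /eqP.
have m1 : measurable E1 by exact: mne.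
have m2 : measurable E2.
  by rewrite -[X in measurable X]setTI; exact: emeasurable_fun_o_infty.
have m3 : measurable E3 by apply: measurableI; exact: mne.
have sub : tail t `<=` E1 `|` E2 `|` E3.
  move=> w; apply: contraPP => /not_orP[/not_orP[n1 n2] n3].
  apply/negP; rewrite -leNgt.
  apply: (@integral_le_superlevel _ _ _ _ _ f0 mf t u x K) => //.
  - by apply/eqP/negPn/negP.
  - have [->//|N0] := eqVneq (N w [set z | x < f z]) 0%E.
    have [->//|N1] := eqVneq (N w [set z | x < f z]) 1%E.
    by case: n3.
  - by rewrite leNgt; apply/negP.
apply: (@le_trans _ _ (P E1 + P E2 + P E3)%E).
  apply: (@le_trans _ _ (P (E1 `|` E2 `|` E3))).
    by apply: le_measure; rewrite ?inE//; do 2 apply: measurableU => //.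
  apply: le_trans (measureU2 _ _ _) _ => //; first exact: measurableU.
  by rewrite leeD2r// measureU2.
rewrite !EFinD; apply: leeD; [apply: leeD|].
- rewrite (poisson_process_ge1 HN) ?GE// lee_fin lerBlDl -lerBlDr.
  by have := expR_ge1Dx (- G u); rewrite -/(G u); lra.
- exact: (poisson_process_tail HN).
rewrite (poisson_process_ge2 HN) ?GE// lee_fin -/(G x).
(* From e^(-b) >= 1 - b follows 1 - e^(-b) (1 + b) <= b^2. *)
have b0 := G0 x; have ab := expR_ge1Dx (- G x).
by move: b0 ab; set b := fine _; set a := expR _ => b0 ab; nra.
Qed.

End compound_poisson_tail.

(** * Regularly varying tails: the one-big-jump principle *)

Section one_big_jump.
Context {R : realType}.

Lemma cvgy_powR_expRN (q : R) : t `^ q * expR (- t) @[t --> +oo] --> 0.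
Proof.
have [n qn] : exists n : nat, q <= n%:R.
  exists (Num.bound `|q|); apply: le_trans (ler_norm q) _; apply/ltW; exact: archi_boundP.
have h1 : n.+2`!%:R * t `^ (- 1) @[t --> +oo] --> (0 : R).
  rewrite -[X in _ --> X](mulr0 n.+2`!%:R); apply: cvgMl_tmp.
  by apply: cvgy_powRN => //; exact: cvg_id.
apply: (squeeze_cvgr _ (cvg_cst 0) h1).
near=> t; have t1 : 1 <= t by near: t; exact: (nbhs_pinfty_ge (num_real 1)).
(* The exponential dominates t^(n+2) / (n+2)!, while t^q <= t^(n+1) for t >= 1; this leaves the
   factor 1/t. *)
have t0 : 0 < t by exact: lt_le_trans t1.
rewrite mulr_ge0 ?powR_ge0 ?expR_ge0//=.
have := expR_ge1Dxn n.+1 (ltW t0) => ht.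
have fact0' : 0 < n.+2`!%:R :> R by rewrite ltr0n fact_gt0.
have ht' : t ^+ n.+2 <= n.+2`!%:R * expR t.
  by rewrite -ler_pdivrMl// mulrC; apply: le_trans ht; rewrite lerDr.
rewrite expRN ler_pdivrMr ?expR_gt0//.
apply: (@le_trans _ _ (t `^ (- 1) * t ^+ n.+2)); last first.
  rewrite mulrAC (mulrC (_ `^ _)) ler_wpM2r ?powR_ge0//.
rewrite -powR_mulrn ?(ltW t0)// -powRD; last by rewrite (lt0r_neq0 t0) implybT.
by apply: ler_powR => //; rewrite -!natr1; lra.
Unshelve. all: by end_near. Qed.

Lemma continuous_powR (q x : R) : 0 < x -> {for x, continuous (fun y => y `^ q)}.
Proof.
move=> x0; apply: differentiable_continuous; apply/derivable1_diffP.
by have [] := is_derive1_powR q x0.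
Qed.

(* The largest jump alone exceeds t, up to the error t^(5/6) made by at most
   t^(1/6) jumps that are smaller than t^(2/3). *)
Lemma one_big_jump_asymptotics (G p : R -> R) (gamma c C : R) :
  0 < gamma -> (forall v, 0 <= G v) ->
  v `^ gamma * G v @[v --> +oo] --> c ->
  (forall t, 0 <= t -> 1 - expR (- G t) <= p t) ->
  (forall t u x K, 0 <= u -> 0 <= x -> u + x * K <= t ->
    p t <= G u + expR (C - K) + G x ^+ 2) ->
  t `^ gamma * p t @[t --> +oo] --> c.
Proof.
move=> g0 G0 Gc plb pub.
have powD (a b t : R) : 0 < t -> t `^ (a + b) = t `^ a * t `^ b.
  by move=> t0; rewrite powRD// (lt0r_neq0 t0) implybT.
have tN (q : R) : 0 < q -> t `^ (- q) @[t --> +oo] --> (0 : R).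
  by move=> q0; apply: cvgy_powRN => //; exact: cvg_id.
have Gt0 : G t @[t --> +oo] --> 0.
  have : t `^ (- gamma) * (t `^ gamma * G t) @[t --> +oo] --> 0 * c.
    by apply: cvgM => //; exact: tN.
  rewrite mul0r; apply: cvg_trans; apply: near_eq_cvg; near=> t.
  have t0 : 0 < t by near: t; exact: (nbhs_pinfty_gt (num_real 0)).
  by rewrite powRN mulKf// lt0r_neq0// powR_gt0.
(* Here u(t) = t - t^(5/6), which is exactly t minus t^(2/3) t^(1/6) and still equivalent to t, so
   that [G (u t)] keeps the constant [c]. *)
pose u (t : R) := t * (1 - t `^ (- 6^-1)).
have u1 : 1 - t `^ (- 6^-1) @[t --> +oo] --> (1 : R).
  rewrite -[X in _ --> X]subr0; apply: cvgB; first exact: cvg_cst.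
  by apply: tN; rewrite invr_gt0.
have uy : u t @[t --> +oo] --> +oo.
  apply/cvgryPge => A; near=> t; rewrite /u.
  have half : 2^-1 <= 1 - t `^ (- 6^-1).
    by near: t; apply: (cvgr_ge 1) => //; rewrite invf_lt1// ltr1n.
  have t0 : 0 < t by near: t; exact: (nbhs_pinfty_gt (num_real 0)).
  have tA : 2 * A <= t by near: t; exact: (nbhs_pinfty_ge (num_real (2 * A))).
  by apply: (@le_trans _ _ (t * 2^-1)); [rewrite ler_pdivlMr// mulrC|rewrite ler_pM2l].
have lim_u : (1 - t `^ (- 6^-1)) `^ (- gamma) * (u t `^ gamma * G (u t)) @[t --> +oo] --> c.
  have lim1 : (1 - t `^ (- 6^-1)) `^ (- gamma) @[t --> +oo] --> (1 : R).
    have := cvg_comp _ _ u1 (continuous_powR (- gamma) 1 ltr01).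
    by rewrite /= powR1.
  by rewrite -[X in _ --> X]mul1r; apply: cvgM lim1 _; exact: cvg_comp uy Gc.
have lim_e : t `^ gamma * expR (C - t `^ 6^-1) @[t --> +oo] --> 0.
  have : expR C * ((t `^ 6^-1) `^ (6 * gamma) * expR (- (t `^ 6^-1))) @[t --> +oo] --> expR C * 0.
    apply: cvgMl_tmp; have ty : t `^ (6^-1 : R) @[t --> +oo] --> +oo.
      by apply: cvgy_powR; rewrite invr_gt0.
    exact: (cvg_comp _ _ ty (cvgy_powR_expRN (6 * gamma))).
  rewrite mulr0; apply: cvg_trans; apply: near_eq_cvg; near=> t.
  by rewrite -powRrM mulKf// expRD; ring.
(* This is t^gamma G(x)^2 for x = t^(2/3), of order t^(gamma - 4 gamma / 3). An exponent of x above
   1/2 is what makes two moderately large jumps negligible. *)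
have lim_x : t `^ (- (gamma / 3)) *
    ((t `^ (2 / 3)) `^ gamma * G (t `^ (2 / 3))) ^+ 2 @[t --> +oo] --> 0.
  have ty : t `^ (2 / 3 : R) @[t --> +oo] --> +oo by exact: cvgy_powR.
  rewrite -[X in _ --> X](mul0r (c * c)); apply: cvgM; first by apply: tN; rewrite divr_gt0.
  have cc := cvg_comp _ _ ty Gc.
  exact: (cvgM cc cc).
(* The lower bound is used as 1 - e^(-G) >= G / (1 + G), a consequence of e^G >= 1 + G. *)
have lim_lb : t `^ gamma * G t * (1 + G t)^-1 @[t --> +oo] --> c.
  rewrite -[X in _ --> X]mulr1; apply: cvgM => //.
  rewrite -[X in _ --> X]invr1; apply: cvgV => //.
  by rewrite -[X in _ --> X]addr0; apply: cvgD => //; exact: cvg_cst.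
have lim_ub : (1 - t `^ (- 6^-1)) `^ (- gamma) * (u t `^ gamma * G (u t)) +
    t `^ gamma * expR (C - t `^ 6^-1) + t `^ (- (gamma / 3)) *
    ((t `^ (2 / 3)) `^ gamma * G (t `^ (2 / 3))) ^+ 2 @[t --> +oo] --> c.
  rewrite -[X in _ --> X]addr0; apply: cvgD => //.
  by rewrite -[X in _ --> X]addr0; apply: cvgD.
apply: (squeeze_cvgr _ lim_lb lim_ub); near=> t.
have t0 : 0 < t by near: t; exact: (nbhs_pinfty_gt (num_real 0)).
have u10 : 0 < 1 - t `^ (- 6^-1) by near: t; apply: (cvgr_gt 1).
have tg : 0 < t `^ gamma by rewrite powR_gt0.
apply/andP; split.
  rewrite -mulrA ler_pM2l//; apply: le_trans (plb t (ltW t0)).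
  have G1 : 0 < 1 + G t by rewrite ltr_wpDr.
  rewrite ler_pdivrMr// expRN.
  have eG := expR_ge1Dx (G t).
  have : (expR (G t))^-1 * (1 + G t) <= 1 by rewrite ler_pdivrMl ?expR_gt0// mulr1.
  by set a := _^-1; nra.
have ut : u t + t `^ (2 / 3) * t `^ 6^-1 <= t.
  rewrite -powD// /u mulrBr mulr1.
  rewrite -[X in _ - X * _](powRr1 (ltW t0)) -powD//.
  rewrite (_ : 1 + - 6^-1 = 2 / 3 + 6^-1); last by field.
  by rewrite subrK.
have := pub t (u t) (t `^ (2 / 3)) (t `^ 6^-1) _ (powR_ge0 _ _) ut.
rewrite mulr_ge0 ?(ltW t0) ?(ltW u10)// => /(_ isT).
rewrite -(ler_pM2l tg) => /le_trans; apply.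
rewrite !mulrDr; apply: lerD; first apply: lerD => //.
- rewrite /u powRM ?(ltW t0) ?(ltW u10)// powRN.
  set a := t `^ gamma; set b := _ `^ gamma; set g := G _.
  have b0 : 0 < b by rewrite powR_gt0.
  by rewrite (_ : b^-1 * (a * b * g) = a * g)//; field; rewrite lt0r_neq0.
- rewrite exprMn [leRHS]mulrA -(powR_mulrn 2 (powR_ge0 _ _)) -!powRrM -powD//.
  by rewrite (_ : - (gamma / 3) + _ = gamma)//; field.
Unshelve. all: by end_near. Qed.

End one_big_jump.

(** * In-degrees *)

Section torus.
Context {R : realType}.

(** On the fundamental domain the floor is 0 for u >= 0 and -1 for u < 0; in both cases the minimum
    selects |u|. *)
Lemma circle_dist0_sqr (n : nat) (u : R) : (0 < n)%N ->
  - (n%:R / 2) <= u < n%:R / 2 -> circle_dist0 n u ^+ 2 = u ^+ 2.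
Proof.
move=> n0 /andP[u1 u2]; have nR0 : 0 < n%:R :> R by rewrite ltr0n.
rewrite /circle_dist0 /=; case: (leP 0 u) => u0.
  rewrite (@floor_def _ _ 0); last first.
    by rewrite divr_ge0//= ?ltr_pdivrMr//; lra.
  by rewrite mulr0 subr0 min_l//; lra.
rewrite (@floor_def _ _ (-1)); last first.
  by rewrite addNr mulrN1z ler_pdivlMr// ltr_pdivrMr// mul0r u0 andbT; lra.
by rewrite mulrN1z mulrN1 opprK min_r; [rewrite opprD addrCA subrr addr0 sqrrN|lra].
Qed.

Lemma torus_norm_eucl (d n : nat) (x : d.-tuple R) : (0 < n)%N ->
  @torus_domain R d n x -> @torus_norm R d n x = eucl_norm x.
Proof.
move=> n0 xn; rewrite /torus_norm /eucl_norm; congr Num.sqrt.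
by apply: eq_bigr => i _; apply: circle_dist0_sqr => //; exact: xn.
Qed.

Lemma measurable_torus_norm (d n : nat) : measurable_fun setT (@torus_norm R d n).
Proof.
apply: (@measurable_sqrtr_sum_sqr _ _ (fun=> circle_dist0 n)) => i.
have mfl : measurable_fun setT (fun u : R => (Num.floor (u / n%:R))%:~R : R).
  apply: nondecreasing_measurable => // u v uv; rewrite ler_int le_floor//.
  by rewrite ler_wpM2r// invr_ge0.
have mw : measurable_fun setT (fun u : R => u - n%:R * (Num.floor (u / n%:R))%:~R : R).
  by apply: measurable_funB => //; exact: measurable_funM.
by apply: measurable_minr => //; exact: measurable_funB.
Qed.

Lemma measurable_torus_domain (d n : nat) : measurable (@torus_domain R d n).
Proof.
rewrite (_ : @torus_domain R d n = [set x : d.-tuple R |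
    forall i, `[- (n%:R / 2), n%:R / 2[%classic (tnth x i)]).
  exact: (@measurable_forall_tnth _ _ (fun=> `[- (n%:R / 2), n%:R / 2[%classic)).
by apply/seteqP; split => x xn i; have := xn i; rewrite /= in_itv.
Qed.

Lemma nondecreasing_torus_domain (d : nat) : nondecreasing_seq (@torus_domain R d).
Proof.
move=> m n mn; apply/subsetPset => x xm i; have /andP[x1 x2] := xm i.
have : (m%:R : R) <= n%:R by rewrite ler_nat.
by move=> mn'; apply/andP; split; lra.
Qed.

Lemma bigcup_torus_domain (d : nat) : \bigcup_n @torus_domain R d n = setT.
Proof.
rewrite -subTset => x _; have [n xn] := bounded_coordinates x.
exists (n + n)%N => // i; have := xn i; rewrite ltr_norml natrD => /andP[x1 x2].
by apply/andP; split; lra.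
Qed.

End torus.

Section restriction.
Context {R : realType} {dT : measure_display} {T : measurableType dT}.
Local Open Scope ereal_scope.

Lemma ge0_integral_mrestr (m : {measure set T -> \bar R}) (E : set T) (mE : measurable E)
    (g : T -> \bar R) : (forall z, 0 <= g z) -> measurable_fun setT g ->
  \int[mrestr m mE]_z g z = \int[m]_(z in E) g z.
Proof.
move=> g0 mg; rewrite (@ge0_negligible_integral _ _ _ _ setT (~` E))//; last 2 first.
- exact: measurableC.
- by rewrite /= /mrestr setICl measure0.
rewrite setTD setCK; apply: eq_measure_integral => A mA AE.
by rewrite /= /mrestr setIidl.
Qed.

Context {dO : measure_display} {Omega : measurableType dO}.
Context {P : probability Omega R} {Lam : set T -> \bar R}.
Context {N : Omega -> {measure set T -> \bar R}}.
Hypothesis HN : is_poisson_process P Lam N.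

(** As the integrals over [E n] increase to the full one, the events shrink to the limiting event,
    and continuity from above applies. *)
Lemma poisson_process_exhaustion (E : (set T)^nat) (g : T -> \bar R) (t : R) :
  (forall n, measurable (E n)) -> nondecreasing_seq E -> \bigcup_n E n = setT ->
  (forall z, 0 <= g z) -> measurable_fun setT g ->
  P [set w | \int[N w]_(z in E n) g z <= t%:E] @[n --> \oo] -->
  P [set w | \int[N w]_z g z <= t%:E].
Proof.
move=> mE ndE cE g0 mg.
have gEx w n : \int[N w]_(z in E n) g z <= \int[N w]_z g z.
  by apply: ge0_subset_integral => //; exact: g0.
have mF n : measurable [set w | \int[N w]_(z in E n) g z <= t%:E].
  rewrite -[X in measurable X]setTI; apply: emeasurable_fun_infty_c => //.
  under eq_fun do rewrite integral_mkcond.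
  apply: (poisson_process_integral_measurable HN).
    by move=> z; apply: erestrict_ge0 => y _; exact: g0.
  by apply/(measurable_restrictT _ (mE n)).1; exact: measurable_funTS.
have ndint w : nondecreasing_seq (fun n => \int[N w]_(z in E n) g z).
  by move=> m n mn; apply: ge0_subset_integral => //; [exact: measurable_funTS|exact/subsetPset/ndE].
have -> : [set w | \int[N w]_z g z <= t%:E] =
    \bigcap_n [set w | \int[N w]_(z in E n) g z <= t%:E].
  apply/seteqP; split => w /=; first by move=> gt n _; exact: le_trans (gEx w n) gt.
  move=> ht; rewrite -cE.
  have c : \int[N w]_(z in E n) g z @[n --> \oo] --> \int[N w]_(z in \bigcup_n E n) g z.
    apply: ge0_nondecreasing_set_cvg_integral => //.
    by move=> n; exact: measurable_funTS.
  have /cvg_lim <- // := c; apply: lime_le; first by apply/cvg_ex; eexists; exact: c.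
  by apply: nearW => n; exact: ht.
apply: nonincreasing_cvg_mu => //.
- by rewrite (le_lt_trans (probability_le1 _ _))// ltry.
- exact: bigcap_measurable.
- by move=> m n mn; apply/subsetPset => w /=; apply: le_trans; exact: ndint.
Qed.

End restriction.

Section divergent_moment.
Context {R : realType} {mu : probability R R} {d : nat} {s beta : R}.
Hypotheses (d0 : (0 < d)%N) (sd : s <= d%:R) (beta0 : 0 < beta).
Hypothesis tail_mu :
  (fun h => h `^ s * fine (mu [set` `]h, +oo[%R])) x @[x --> +oo] --> beta.

(* Only the mass of ]2 rho, +oo[ is kept, where the excess is at least rho^d. *)
Lemma excess_moment_ge : \forall rho \near +oo,
  ((2^-1 ^+ d * (beta / 2))%:E <= \int[mu]_r (@excess R d rho r)%:E)%E.
Proof.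
have [M [_ HM]] : \forall h \near +oo, beta / 2 <= h `^ s * fine (mu [set` `]h, +oo[%R]).
  by apply: (cvgr_ge beta tail_mu); rewrite ltr_pdivrMr// ltr_pMr// ltr1n.
near=> rho.
have rho1 : 1 <= rho by near: rho; exact: (nbhs_pinfty_ge (num_real 1)).
have rhoM : M < rho by near: rho; exact: (nbhs_pinfty_gt (num_real M)).
have rho0 : 0 < rho by exact: lt_le_trans rho1.
pose A : set R := `]2 * rho, +oo[%classic.
have mA : measurable A by exact: measurable_itv.
apply: (@le_trans _ _ (\int[mu]_(r in A) (rho ^+ d)%:E)%E).
  rewrite integral_cst// -[X in (_ * X)%E]fineK ?fin_num_measure// -EFinM lee_fin.
  (* The tail at 2 rho is at least (beta / 2) (2 rho)^(-s), and (2 rho)^s <= (2 rho)^d since s <= d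
     and 2 rho >= 1. Multiplication by rho^d leaves 2^(-d) beta / 2. *)
  have h2 : M < 2 * rho by lra.
  have := HM _ h2; rewrite -/A => hb.
  rewrite exprVn -ler_pdivlMl ?invr_gt0 ?exprn_gt0// invrK mulrA -exprMn.
  apply: le_trans hb _; rewrite ler_wpM2r ?fine_ge0// -powR_mulrn; last lra.
  by apply: ler_powR => //; lra.
apply: (@le_trans _ _ (\int[mu]_(r in A) (@excess R d rho r)%:E)%E).
  apply: ge0_le_integral => //.
  - by move=> r _; rewrite lee_fin exprn_ge0// ltW.
  - by apply: measurable_funTS; apply/measurable_EFinP; exact: measurable_excess.
  - move=> r; rewrite /A/= in_itv/= andbT => rr.
    rewrite lee_fin /excess le_max; apply/orP; right.
    have r0 : 0 <= r by lra.
    rewrite (max_idPr r0) lerBrDr -mulr2n.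
    apply: (@le_trans _ _ ((2 * rho) ^+ d)); last by rewrite lerXn2r ?nnegrE//; lra.
    rewrite exprMn -[leLHS]mulr_natl ler_wpM2r ?exprn_ge0 ?(ltW rho0)//.
    by rewrite -[leLHS]expr1 ler_weXn2l ?ler1n.
apply: ge0_subset_integral => //.
  by apply/measurable_EFinP; exact: measurable_excess.
by move=> r _; rewrite lee_fin excess_ge0.
Unshelve. all: by end_near. Qed.

End divergent_moment.

Section in_degree.
Context {R : realType} {d : nat}.

Definition in_summand (nrm : d.-tuple R -> R) (alpha : R) (z : d.-tuple R * R) : R :=
  if nrm z.1 <= z.2 then nrm z.1 `^ alpha else 0.

Lemma in_summand_ge0 nrm alpha z : 0 <= in_summand nrm alpha z.
Proof. by rewrite /in_summand; case: ifP => // _; exact: powR_ge0. Qed.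

Lemma measurable_in_summand nrm alpha : measurable_fun setT nrm ->
  measurable_fun setT (in_summand nrm alpha).
Proof.
move=> mn; have mn1 : measurable_fun setT (fun z : d.-tuple R * R => nrm z.1).
  exact: measurableT_comp.
apply: measurable_fun_if => //.
- exact: measurable_fun_ler.
- by apply: measurable_funTS; exact: (measurableT_comp (measurable_powR alpha) mn1).
Qed.

(** A level v >= 0 excludes the points that do not reach the origin, whose summand is 0, and for
    alpha > 0 the power is strictly increasing. The factor 1/alpha in the tail exponent comes from
    here. *)
Lemma superlevel_in_summand (alpha v : R) : 0 < alpha -> 0 <= v ->
  [set z | v < in_summand (@eucl_norm R d) alpha z] = reach_beyond (v `^ alpha^-1).
Proof.
move=> a0 v0; apply/seteqP; split => z; rewrite /in_summand /reach_beyond/=.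
  case: ifP => zz; last by rewrite ltNge v0.
  move=> vz; split => //.
  have := @gt0_ltr_powR R alpha^-1 _ _ _ _ _ vz.
  rewrite -powRrM divff ?lt0r_neq0// powRr1 ?eucl_norm_ge0//.
  by apply; rewrite ?invr_gt0// nnegrE ?powR_ge0.
move=> [-> vz]; have := @gt0_ltr_powR R alpha a0 _ _ _ _ vz.
rewrite -powRrM mulVf ?lt0r_neq0// powRr1//.
by apply; rewrite nnegrE ?powR_ge0 ?eucl_norm_ge0.
Qed.

End in_degree.

Section in_degree_distribution.
Context {R : realType} {d : nat} {lam : {measure set (d.-tuple R) -> \bar R}}.
Context {mu : probability R R} {s beta alpha : R}.
Context {dO : measure_display} {O : measurableType dO} {P : probability O R}.
Context {N : O -> {measure set (d.-tuple R * R) -> \bar R}}.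
Hypotheses (d0 : (0 < d)%N) (lamP : is_lebesgue_Rd lam).
Hypotheses (beta0 : 0 < beta) (alpha0 : 0 <= alpha).
Hypothesis mu_ge0 : mu [set` `]-oo, 0[%R] = 0%E.
Hypothesis tail_mu :
  (fun h => h `^ s * fine (mu [set` `]h, +oo[%R])) x @[x --> +oo] --> beta.
Hypothesis HN : is_poisson_process P (marked_intensity lam setT mu) N.

Local Notation kappa := (unit_ball_volume lam).
Local Notation Lam := (marked_intensity lam setT mu).
Local Notation D_eucl := (D_in (@eucl_norm R d)).

Let Lam_ge0 C : (0 <= Lam C)%E.
Proof. by rewrite marked_intensityE measure_ge0. Qed.

Lemma D_in_torus_cvg (dn : nat -> measure_display)
    (On : forall n, measurableType (dn n)) (Pn : forall n, probability (On n) R)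
    (Nn : forall n, On n -> {measure set (d.-tuple R * R) -> \bar R}) :
  (forall n : nat, (0 < n)%N ->
     is_poisson_process (Pn n) (marked_intensity lam (@torus_domain R d n) mu) (Nn n)) ->
  cvg_in_distribution Pn (fun n w => D_in (@torus_norm R d n) alpha (Nn n w))
    P (fun w => D_eucl alpha (N w)).
Proof.
move=> HNn t _.
pose E n := @torus_domain R d n `*` [set: R].
have mE n : measurable (E n).
  by apply: measurableX => //; exact: measurable_torus_domain.
have ndE : nondecreasing_seq E.
  move=> m n mn; apply/subsetPset => z [zm _]; split => //.
  by apply: (elimT (subsetPset _ _) (nondecreasing_torus_domain d m n mn)).
have cE : \bigcup_n E n = setT.
  rewrite -subTset => z _; have [n _ zn] : (\bigcup_n @torus_domain R d n) z.1.
    by rewrite bigcup_torus_domain.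
  by exists n.
have mf nrm : measurable_fun setT nrm ->
    measurable_fun setT (fun z : d.-tuple R * R => (in_summand nrm alpha z)%:E).
  by move=> mn; apply/measurable_EFinP; exact: measurable_in_summand.
have f0 nrm (z : d.-tuple R * R) : (0 <= (in_summand nrm alpha z)%:E)%E.
  by rewrite lee_fin in_summand_ge0.
have := poisson_process_exhaustion HN E _ t mE ndE cE (f0 (@eucl_norm R d))
  (mf _ measurable_eucl_norm).
(* For each n >= 1 the probability for the torus equals the one for the restricted process, so the
   limit transfers unchanged. *)
apply: cvg_trans; apply: near_eq_cvg; exists 1%N => // n /= n0.
(* The comparison of laws needs finite intensities; here they are bounded by the volume of the
   torus, the marks having total mass 1. *)
have Lfin A : measurable A -> (marked_intensity lam (@torus_domain R d n) mu A < +oo)%E.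
  move=> mA; rewrite marked_intensity_restr marked_intensityE.
  apply: (@le_lt_trans _ _ ((lam \x mu)%E (E n))).
    apply: le_measure; rewrite ?inE; [exact: (measurableI _ _ mA (mE n))|exact: mE|exact: subIsetr].
  rewrite product_measure1E//; last exact: measurable_torus_domain.
  rewrite [X in (_ * X)%E](_ : _ = 1%E) ?mule1; last exact: (probability_setT mu).
  apply: (lebesgue_Rd_bounded lamP (n%:R)); first exact: measurable_torus_domain.
  move=> x xn i; have /andP[x1 x2] := xn i; have n1 : (0 : R) <= n%:R by [].
  by rewrite ler_norml; apply/andP; split; lra.
have L0 A : measurable A -> (0 <= marked_intensity lam (@torus_domain R d n) mu A)%E.
  by move=> mA; rewrite marked_intensity_restr.
transitivity (P [set w | (\int[mrestr (N w) (mE n)]_z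
    (in_summand (@torus_norm R d n) alpha z)%:E <= t%:E)%E]).
  have restrE w : (\int[mrestr (N w) (mE n)]_z
      (in_summand (@torus_norm R d n) alpha z)%:E =
      \int[N w]_(z in E n) (in_summand (@eucl_norm R d) alpha z)%:E)%E.
    rewrite (ge0_integral_mrestr (N w) (E n) (mE n) _ (f0 _) (mf _ (measurable_torus_norm d n))).
    apply: eq_integral => z; rewrite inE => -[zn _].
    by rewrite /in_summand torus_norm_eucl.
  by congr (P _); apply: eq_set => w; rewrite restrE.
symmetry.
apply: (poisson_process_integral_eq_law (HNn n n0) (poisson_process_restr HN _ (mE n)) L0 Lfin).
- by move=> A mA; rewrite marked_intensity_restr.
- exact: f0.
- exact: mf (measurable_torus_norm d n).
Qed.

Let measurable_D_eucl a : measurable_fun setT (fun w => D_eucl a (N w)).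
Proof.
apply: (poisson_process_integral_measurable HN).
  by move=> z; rewrite lee_fin; exact: (in_summand_ge0 (@eucl_norm R d)).
by apply/measurable_EFinP; apply: measurable_in_summand; exact: measurable_eucl_norm.
Qed.

(* If the intensity were finite, the intensities of the sets [reach_beyond n],
   which decrease to the empty set, would tend to 0. *)
Lemma reach_beyond_intensity_infty : s <= d%:R -> Lam (reach_beyond 1) = +oo%E.
Proof.
move=> sd; apply/eqP; apply: contraT; rewrite -ltey => Loo.
pose A n := @reach_beyond R d n.+1%:R.
have capA : \bigcap_n A n = set0.
  rewrite -subset0 => z zA; have [_ zn] := zA (Num.bound (eucl_norm z.1)) I.
  have := archi_boundP (eucl_norm_ge0 z.1); rewrite ltNge => /negP; apply.
  by apply: le_trans (ltW zn); rewrite ler_nat.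
have mA n : measurable (A n) by exact: measurable_reach_beyond.
have cvg0 : (lam \x mu)%E (A n) @[n --> \oo] --> 0%E.
  have := @nonincreasing_cvg_mu _ _ _ (lam \x mu)%E A.
  rewrite capA measure0; apply => //.
  - by move: Loo; rewrite marked_intensityE.
  - move=> m n mn; apply/subsetPset => z [zz zn]; split => //.
    by apply: le_lt_trans zn; rewrite ler_nat.
(* By [excess_moment_ge] this constant, independent of n, bounds the intensity of [A n] from below
   for all large n. *)
pose b : R := fine kappa * (2^-1 ^+ d * (beta / 2)).
have k0 : 0 < fine kappa.
  by rewrite fine_gt0// (unit_ball_volume_gt0 lamP)// (unit_ball_volume_lty lamP).
have b0 : 0 < b by rewrite !mulr_gt0 ?exprn_gt0 ?invr_gt0.
have bA : \forall n \near \oo, (b%:E <= (lam \x mu)%E (A n))%E.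
  have [M [_ HM]] := excess_moment_ge d0 sd beta0 tail_mu.
  near=> n; rewrite -marked_intensityE reach_beyond_intensity//.
  rewrite /b EFinM fineK ?(unit_ball_volume_fin_num lamP)//.
  apply: lee_wpmul2l; first exact: measure_ge0.
  apply: HM; apply: (@lt_le_trans _ _ n%:R); last by rewrite ler_nat.
  by near: n; exact: nbhs_infty_gtr.
have : (b%:E <= 0)%E.
  have /cvg_lim <- // := cvg0; apply: lime_ge; last exact: bA.
  by apply/cvg_ex; eexists; exact: cvg0.
by rewrite lee_fin leNgt b0.
Unshelve. all: by end_near. Qed.

(** Beyond radius 1 each summand is at least 1, so the sum dominates the number of points in
    [reach_beyond 1], which is almost surely infinite. In all of [reach], infinitely many points
    alone would not suffice, since summands near the origin can be small. *)
Lemma D_in_infty : s <= d%:R -> P [set w | D_eucl alpha (N w) = +oo%E] = 1%E.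
Proof.
move=> sd; have mA := @measurable_reach_beyond R d 1.
have [_ _ _ Hoo _] := HN.
have mD : measurable [set w | D_eucl alpha (N w) = +oo%E].
  rewrite (_ : mkset _ = [set: O] `&` (fun w => D_eucl alpha (N w)) @^-1` [set +oo%E]).
    exact: (measurable_D_eucl alpha measurableT).
  by rewrite setTI.
apply/eqP; rewrite eq_le probability_le1//=.
rewrite -(Hoo _ mA (reach_beyond_intensity_infty sd)); apply: le_measure; rewrite ?inE//.
  exact: (poisson_process_level_measurable HN).
move=> w /= Noo; apply/eqP; rewrite -leye_eq -Noo.
rewrite -[leLHS]mul1e -integral_cst//.
apply: (@le_trans _ _ (\int[N w]_(z in reach_beyond 1)
    (in_summand (@eucl_norm R d) alpha z)%:E)%E).
  apply: ge0_le_integral => //.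
  - apply: measurable_funTS; apply/measurable_EFinP; apply: measurable_in_summand.
    exact: measurable_eucl_norm.
  - move=> z [zz z1]; rewrite lee_fin /in_summand zz.
    by rewrite -[leLHS](powRr0 (eucl_norm z.1)) ler_powR// ltW.
apply: ge0_subset_integral => //.
  apply/measurable_EFinP; apply: measurable_in_summand; exact: measurable_eucl_norm.
by move=> z _; rewrite lee_fin in_summand_ge0.
Qed.

Lemma reach_intensity_moment : Lam reach = (kappa * \int[mu]_r ((r ^+ d)%:E))%E.
Proof.
rewrite (reach_intensity lamP d0); congr (_ * _)%E; apply: ae_eq_integral => //.
- by apply/measurable_EFinP; apply: measurable_funX; exact: measurable_maxr.
- by apply/measurable_EFinP; exact: measurable_funX.
exists [set` `]-oo, 0[%R]; split => // r /= rn; rewrite in_itv/= ltNge; apply/negP => r0.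
by apply: rn => _; rewrite (max_idPr r0).
Qed.

Lemma reach_intensity_lty : d%:R < s -> (Lam reach < +oo)%E.
Proof.
move=> ds; rewrite (reach_intensity lamP d0).
have := positive_part_moment_lty d0 ds beta0 tail_mu => mlty.
rewrite -ge0_fin_numE ?mule_ge0 ?measure_ge0//; last first.
  by apply: integral_ge0 => r _; rewrite lee_fin exprn_ge0// le_max lexx.
rewrite fin_numM ?(unit_ball_volume_fin_num lamP)// ge0_fin_numE//.
by apply: integral_ge0 => r _; rewrite lee_fin exprn_ge0// le_max lexx.
Qed.

(** The zeroth power is 1 even at the origin, so the sum is a plain count and its law can be read
    off from the Poisson process. *)
Lemma D_in0_reach w : D_eucl 0 (N w) = N w reach.
Proof.
rewrite /D_in -[in RHS](setIT reach) -integral_indic//; last exact: measurable_reach.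
apply: eq_integral => z _; rewrite indicE; congr EFin.
case: ifP => zz; first by rewrite mem_set// powRr0.
by rewrite memNset//= /reach/= zz.
Qed.

Lemma D_in_tail : 0 < alpha -> d%:R < s ->
  (fun t => t `^ ((s - d%:R) / alpha) *
     fine (P [set w | (t%:E < D_eucl alpha (N w))%E]))
    x @[x --> +oo] --> d%:R * fine kappa * beta / (s - d%:R).
Proof.
move=> a0 ds; pose f := in_summand (@eucl_norm R d) alpha.
have f0 z : 0 <= f z by exact: in_summand_ge0.
have mf : measurable_fun setT f.
  by apply: measurable_in_summand; exact: measurable_eucl_norm.
(* The compound Poisson bounds expect the intensity as a bundled measure, which the product measure
   is. *)
have HN' : is_poisson_process P (lam \x mu)%E N.
  by rewrite (_ : (lam \x mu)%E = Lam)//; apply/funext => C; rewrite marked_intensityE.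
have Lf : ((lam \x mu)%E [set z | (0 < f z)%R] < +oo)%E.
  apply: le_lt_trans (reach_intensity_lty ds); rewrite marked_intensityE.
  apply: le_measure; rewrite ?inE; [exact: measurable_superlevel|exact: measurable_reach|].
  by move=> z /=; rewrite /f /in_summand /reach/=; case: ifP => //; rewrite ltxx.
pose G v := fine ((lam \x mu)%E [set z | v < f z]).
have ge0 : 0 < (s - d%:R) / alpha by rewrite divr_gt0// subr_gt0.
apply: (one_big_jump_asymptotics G _ _ _ (G 0 * expR 1 - G 0) ge0).
- by move=> v; rewrite fine_ge0.
(* Under rho = v^(1/alpha) the weight v^((s-d)/alpha) becomes rho^(s-d), so the tail of a single
   jump is kappa times the excess moment already estimated. *)
- pose phi (rho : R) := rho `^ (s - d%:R) * fine (\int[mu]_r (@excess R d rho r)%:E)%E.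
  have cphi : fine kappa * phi (v `^ alpha^-1) @[v --> +oo] -->
      fine kappa * (d%:R * beta / (s - d%:R)).
    have vy : v `^ alpha^-1 @[v --> (+oo : set_system R)] --> +oo.
      by apply: cvgy_powR; rewrite invr_gt0.
    apply: cvgMl_tmp; apply: (cvg_comp _ phi vy).
    exact: (excess_moment_asymptotics d0 ds beta0 tail_mu).
  rewrite (_ : d%:R * fine kappa * beta / (s - d%:R) =
    fine kappa * (d%:R * beta / (s - d%:R))); last by ring.
  apply: cvg_trans cphi; apply: near_eq_cvg; near=> v.
  have v0 : 0 <= v by near: v; exact: (nbhs_pinfty_ge (num_real 0)).
  rewrite /G /f superlevel_in_summand// -marked_intensityE.
  rewrite (reach_beyond_intensity lamP d0) ?powR_ge0//.
  rewrite fineM ?(unit_ball_volume_fin_num lamP)//; last first.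
    by apply: (excess_moment_fin_num d0 ds beta0 tail_mu); exact: powR_ge0.
  by rewrite /phi -powRrM (mulrC alpha^-1) mulrCA.
- by move=> t t0; exact: (compound_poisson_tail_ge HN' f0 mf Lf).
- by move=> t u x K u0 x0 ut; exact: (compound_poisson_tail_le HN' f0 mf Lf).
Unshelve. all: by end_near. Qed.

End in_degree_distribution.

Theorem theorem2p2 (R : realType) (d : nat)
    (lam : {measure set (d.-tuple R) -> \bar R})
    (mu : probability R R) (s beta alpha : R)
    (dn : nat -> measure_display) (On : forall n, measurableType (dn n))
    (Pn : forall n, probability (On n) R)
    (Nn : forall n, On n -> {measure set (d.-tuple R * R) -> \bar R})
    (dO : measure_display) (O : measurableType dO) (P : probability O R)
    (N : O -> {measure set (d.-tuple R * R) -> \bar R}) :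
  (2 <= d)%N ->
  (* lam is Lebesgue measure on R^d *)
  is_lebesgue_Rd lam ->
  (* the mark distribution mu (law of R): absolutely continuous, nonnegative,
     with tail h^s P(R > h) -> beta *)
  (forall A : set R, measurable A -> lebesgue_measure A = 0%E -> mu A = 0%E) ->
  mu [set` `]-oo, 0[%R] = 0%E ->
  0 < s -> 0 < beta ->
  (fun h => h `^ s * fine (mu [set` `]h, +oo[%R])) x @[x --> +oo] --> beta ->
  (* X^(n): independently marked unit-intensity Poisson process on T_n *)
  (forall n : nat, (0 < n)%N ->
     is_poisson_process (Pn n) (marked_intensity lam (@torus_domain R d n) mu) (Nn n)) ->
  (* X: independently marked unit-intensity Poisson process on R^d *)
  is_poisson_process P (marked_intensity lam setT mu) N ->
  0 <= alpha ->
  [/\ cvg_in_distribution Pn (fun n w => D_in (@torus_norm R d n) alpha (Nn n w))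
        P (fun w => D_in (@eucl_norm R d) alpha (N w)),
      (s <= d%:R ->
        P [set w | D_in (@eucl_norm R d) alpha (N w) = +oo%E] = 1%E),
      (d%:R < s ->
        let m := (unit_ball_volume lam * \int[mu]_r ((r ^+ d)%:E))%E in
        (m < +oo)%E /\
        forall k : nat, P [set w | D_in (@eucl_norm R d) 0 (N w) = (k%:R)%:E] =
                        (poisson_p (fine m) k)%:E) &
      (0 < alpha -> d%:R < s ->
        (fun t => t `^ ((s - d%:R) / alpha) *
           fine (P [set w | (t%:E < D_in (@eucl_norm R d) alpha (N w))%E]))
          x @[x --> +oo] -->
        d%:R * fine (unit_ball_volume lam) * beta / (s - d%:R))].

Proof.
move=> d2 lamP _ mu_ge0 s0 beta0 tail_mu HNn HN alpha0.
have d0 : (0 < d)%N by exact: leq_trans d2.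
split.
- exact: (D_in_torus_cvg lamP HN dn On Pn Nn HNn).
- exact: (D_in_infty d0 lamP beta0 alpha0 tail_mu HN).
- move=> ds m; have mE : m = marked_intensity lam setT mu reach.
    by rewrite (reach_intensity_moment d0 lamP mu_ge0).
  have moo : (m < +oo)%E by rewrite mE (reach_intensity_lty d0 lamP beta0 tail_mu).
  split => // k; under eq_set do rewrite D_in0_reach.
  have [_ _ Hk _ _] := HN; rewrite mE Hk//; first exact: measurable_reach.
  by rewrite -mE.
- exact: (D_in_tail d0 lamP beta0 tail_mu HN).
Qed.
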